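(* Let $F$ be a Clairaut semi-invariant Riemannian map with $s=e^f$ from a Riemannian manifold $(M,g_M)$ to a Kähler manifold $(N,g_N,P)$ such that $(\mathrm{range}\,F_\ast)^\perp$ is totally geodesic and $\ker F_\ast$ is minimal. Then $F$ is harmonic if and only if $$\mathrm{trace}\left\{\omega S_{\omega F_\ast X}F_\ast X-C\nabla^{F\perp}_X\omega F_\ast X-\big(\nabla^N_XP\phi F_\ast X\big)^{(\mathrm{range}\,F_\ast)^\perp}\right\}=0,$$ where $X\in\Gamma((\ker F_\ast)^\perp)$.
   Context: $\nabla^M,\nabla^N$ are the Levi-Civita connections and $\Gamma(\cdot)$ denotes sections. $F:M\to N$ is smooth with $0<\mathrm{rank}\,F<\min\{\dim M,\dim N\}$; $(\ker F_\ast)^\perp\subset TM$ and $(\mathrm{range}\,F_\ast)^\perp\subset TN$ are orthogonal complements, and $\mathrm{range}\,F_\ast$, $(\mathrm{range}\,F_\ast)^\perp$ are regarded as complementary orthogonal distributions on $N$. $F$ is a Riemannian map if $g_N(F_\ast X,F_\ast Y)=g_M(X,Y)$ for all $X,Y\in\Gamma((\ker F_\ast)^\perp)$. $F$ is harmonic if the trace over $TM$ of its second fundamental form $(\nabla F_\ast)(X,Y)=\nabla^F_XF_\ast Y-F_\ast(\nabla^M_XY)$ vanishes, $\nabla^F$ being the pullback of $\nabla^N$. $\ker F_\ast$ minimal means that the fibres (leaves of $\ker F_\ast$) are minimal submanifolds of $M$. For $V\in\Gamma((\mathrm{range}\,F_\ast)^\perp)$, $\nabla^N_{F_\ast X}V=-S_VF_\ast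 X+\nabla^{F\perp}_XV$, with $-S_VF_\ast X$ the $\mathrm{range}\,F_\ast$-component and $\nabla^{F\perp}_XV$ the $(\mathrm{range}\,F_\ast)^\perp$-component. $(\mathrm{range}\,F_\ast)^\perp$ is totally geodesic if $\nabla^N_UV\in\Gamma((\mathrm{range}\,F_\ast)^\perp)$ for all $U,V\in\Gamma((\mathrm{range}\,F_\ast)^\perp)$. $(N,g_N,P)$ is Kähler: $P$ is a $(1,1)$ tensor with $P^2=-I$, $g_N(P\cdot,P\cdot)=g_N$, $\nabla^NP=0$. A Riemannian map $F$ to $N$ is semi-invariant if there are subbundles $D_1,D_2$ with $\mathrm{range}\,F_\ast=D_1\oplus D_2$ (orthogonal), $P(D_1)=D_1$ and $P(D_2)\subseteq(\mathrm{range}\,F_\ast)^\perp$. For $F_\ast X\in\Gamma(\mathrm{range}\,F_\ast)$ write $PF_\ast X=\phi F_\ast X+\omega F_\ast X$ with $\phi F_\ast X\in\Gamma(D_1)$, $\omega F_\ast X\in\Gamma(PD_2)$. For $V\in\Gamma((\mathrm{range}\,F_\ast)^\perp)$ write $PV=BV+CV$ with $BV\in\Gamma(\mathrm{range}\,F_\ast)$ and $CV\in\Gamma(\eta)$, where $\eta$ is the orthogonal complement of $PD_2$ in $(\mathrm{range}\,F_\ast)^\perp$. In the claim, $\nabla^N_XP\phi F_\ast X$ means $\nabla^N_{F_\ast X}P\phi F_\ast X$, the superscript $(\mathrm{range}\,F_\ast)^\perp$ denotes the component in $(\mathrm{range}\,F_\ast)^\perp$, and the trace is taken over $(\ker F_\ast)^\perp$,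 i.e. it is the sum of the expression over $X=X_i$ for a local orthonormal frame $\{X_i\}$ of $(\ker F_\ast)^\perp$. $F$ is Clairaut if there is a function $s:N\to\mathbb R^+$ such that for every geodesic $\beta$ on $N$ the function $(s\circ\beta)\sin\theta(t)$ is constant, where $F_\ast X\in\Gamma(\mathrm{range}\,F_\ast)$ and $V\in\Gamma((\mathrm{range}\,F_\ast)^\perp)$ are the components of $\dot\beta(t)$ and $\theta(t)$ is the angle between $\dot\beta(t)$ and $V$. A Clairaut semi-invariant Riemannian map is a semi-invariant Riemannian map to a Kähler manifold that is Clairaut in this sense; ''with $s=e^f$'' means $s=e^f$ for a smooth function $f$ on $N$. *)

(* Defs.v *)
From HB Require Import structures.
From mathcomp Require Import all_boot all_order all_algebra.
From mathcomp Require Import all_classical all_reals all_analysis.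

Set Implicit Arguments.
Unset Strict Implicit.
Unset Printing Implicit Defensive.

Import Order.TTheory GRing.Theory Num.Theory.
Import numFieldNormedType.Exports.

Local Open Scope classical_set_scope.
Local Open Scope ring_scope.

(* Subspaces of 'rV_n are row spaces of matrices and
   linear maps act on row vectors from the right. *)

Section Smoothness.
Context {R : realType} {V W : normedModType R}.

(* C^k on an open subset [A] of a finite-dimensional [V]. *)
Fixpoint Ck_on (k : nat) (A : set V) (f : V -> W) : Prop :=
  match k with
  | 0 => forall x, A x -> {for x, continuous f}
  | k'.+1 => (forall x, A x -> differentiable f x) /\
             (forall v, Ck_on k' A (fun x => 'D_v f x))
  end.

Definition smooth_on (A : set V) (f : V -> W) := forall k, Ck_on k A f.

End Smoothness.

(* [chart_inv] is only meaningful on [chart_map @` chart_dom]. *)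
Record chart (R : realType) (m : nat) (M : topologicalType) := Chart {
  chart_dom : set M;
  chart_map : M -> 'rV[R]_m;
  chart_inv : 'rV[R]_m -> M;
  chart_dom_open : open chart_dom;
  chart_im_open : open (chart_map @` chart_dom);
  chart_mapK : forall p, chart_dom p -> chart_inv (chart_map p) = p;
  chart_map_cont : forall p, chart_dom p -> {for p, continuous chart_map};
  chart_inv_cont : forall p, chart_dom p ->
    {for chart_map p, continuous chart_inv} }.

(* The atlas is given as a choice [chart_at p] of a chart around each point
   (every atlas of a smooth structure contains such a family, which is itself
   an atlas of that structure).  The tangent space at [p] is then 'rV[R]_m, a
   vector being represented by its components in the chart [chart_at p]. *)
Record manifold (R : realType) (m : nat) := Manifold {
  carrier :> topologicalType;
  chart_at : carrier -> chart R m carrier;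
  manifold_hausdorff : hausdorff_space carrier;
  manifold_second_countable : @second_countable carrier;
  mem_chart_at : forall p, chart_dom (chart_at p) p;
  chart_compat : forall p q,
    smooth_on (chart_map (chart_at p) @`
                 (chart_dom (chart_at p) `&` chart_dom (chart_at q)))
      (chart_map (chart_at q) \o chart_inv (chart_at p)) }.

Section Calculus.
Context {R : realType} {m : nat} {M : manifold R m}.
Implicit Types (U : set M) (p q x : M).

Definition cdom p : set M := chart_dom (chart_at p).
Definition cmap p : M -> 'rV[R]_m := chart_map (chart_at p).
Definition cinv p : 'rV[R]_m -> M := chart_inv (chart_at p).

(* Change of components at [x], from the chart at [p] to the chart at [q]. *)
Definition trans p q x : 'M[R]_m := jacobian (cmap q \o cinv p) (cmap p x).

(* The local vector field with constant components [u] in the chart at [p]. *)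
Definition const_field p (u : 'rV[R]_m) : M -> 'rV[R]_m :=
  fun q => u *m trans p q q.

Definition smooth_fun U (h : M -> R) :=
  forall p, smooth_on (cmap p @` (cdom p `&` U)) (h \o cinv p : _ -> R^o).

(* The derivative of [h] at [p] in the direction of the tangent vector [v]. *)
Definition dfun (h : M -> R) p (v : 'rV[R]_m) : R :=
  'D_v (h \o cinv p : _ -> R^o) (cmap p p).

End Calculus.

Section Maps.
Context {R : realType} {m n : nat} {M : manifold R m} {N : manifold R n}.

Definition smooth_map (F : M -> N) :=
  continuous F /\
  forall p q, smooth_on (cmap p @` (cdom p `&` F @^-1` cdom q))
                (cmap q \o F \o cinv p).

Definition tangent_map (F : M -> N) (p : M) : 'M[R]_(m, n) :=
  jacobian (cmap (F p) \o F \o cinv p) (cmap p p).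

(* [V p] is a tangent vector of N at [F p]: a vector field along [F]. *)
Definition smooth_along (F : M -> N) (U : set M) (V : M -> 'rV[R]_n) :=
  forall p q, smooth_on (cmap p @` (cdom p `&` U `&` F @^-1` cdom q))
    ((fun x => V x *m trans (F x) q (F x)) \o cinv p).

(* [A p] is a subspace of the tangent space of N at [F p]. *)
Definition is_subbundle_along (F : M -> N) (A : M -> 'M[R]_n) :=
  forall p, exists U : set M, [/\ open U, U p &
    exists k (E : 'I_k -> M -> 'rV[R]_n),
      (forall i, smooth_along F U (E i)) /\
      (forall q, U q -> row_free (\matrix_i E i q) /\
                        (\matrix_i E i q == A q)%MS)].

End Maps.

Definition smooth_field {R : realType} {m : nat} {M : manifold R m}
  (U : set M) (X : M -> 'rV[R]_m) := smooth_along (idfun : M -> M) U X.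

Definition is_distribution {R : realType} {m : nat} {M : manifold R m}
  (A : M -> 'M[R]_m) := is_subbundle_along (idfun : M -> M) A.

Section InnerProduct.
Context {R : realType} {n : nat}.

Definition ip (G : 'M[R]_n) (u v : 'rV[R]_n) : R := (u *m G *m v^T) 0 0.
Definition inorm (G : 'M[R]_n) (u : 'rV[R]_n) : R := Num.sqrt (ip G u u).

(* As x / 0 = 0, the angle is pi / 2 when one of the vectors is 0. *)
Definition angle (G : 'M[R]_n) (u v : 'rV[R]_n) : R :=
  acos (ip G u v / (inorm G u * inorm G v)).

Definition orthcomp (G : 'M[R]_n) k (A : 'M[R]_(k, n)) : 'M[R]_n :=
  kermx (G *m A^T).

End InnerProduct.

Section Riemannian.
Context {R : realType} {m : nat} (M : manifold R m).

Definition is_metric (g : M -> 'M[R]_m) :=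
  [/\ forall p, (g p)^T = g p,
      forall p v, v != 0 -> 0 < ip (g p) v v &
      forall (U : set M) X Y, open U -> smooth_field U X -> smooth_field U Y ->
        smooth_fun U (fun p => ip (g p) (X p) (Y p))].

(* [nabla p v Y] is the covariant derivative at [p], in the direction [v], of a
   vector field [Y] that is smooth around [p]. *)
Definition connection_op := M -> 'rV[R]_m -> (M -> 'rV[R]_m) -> 'rV[R]_m.

Definition is_connection (nabla : connection_op) :=
  [/\ forall (U : set M) p a u v Y, open U -> U p -> smooth_field U Y ->
        nabla p (a *: u + v) Y = a *: nabla p u Y + nabla p v Y,
      forall (U : set M) p v Y Z, open U -> U p ->
        smooth_field U Y -> smooth_field U Z ->
        nabla p v (fun q => Y q + Z q) = nabla p v Y + nabla p v Z,
      forall (U : set M) p v h Y, open U -> U p ->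
        smooth_fun U h -> smooth_field U Y ->
        nabla p v (fun q => h q *: Y q)
        = dfun h p v *: Y p + h p *: nabla p v Y &
      forall (U : set M) X Y, open U -> smooth_field U X -> smooth_field U Y ->
        smooth_field U (fun p => nabla p (X p) Y)].

(* nabla_X Y - nabla_Y X = [X, Y], the bracket being the derivation
   h |-> X (Y h) - Y (X h). *)
Definition torsion_free (nabla : connection_op) :=
  forall (U : set M) X Y h p, open U -> U p ->
    smooth_field U X -> smooth_field U Y -> smooth_fun U h ->
    dfun h p (nabla p (X p) Y - nabla p (Y p) X)
    = dfun (fun q => dfun h q (Y q)) p (X p)
      - dfun (fun q => dfun h q (X q)) p (Y p).

Definition metric_compatible (g : M -> 'M[R]_m) (nabla : connection_op) :=
  forall (U : set M) Y Z p v, open U -> U p ->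
    smooth_field U Y -> smooth_field U Z ->
    dfun (fun q => ip (g q) (Y q) (Z q)) p v
    = ip (g p) (nabla p v Y) (Z p) + ip (g p) (Y p) (nabla p v Z).

Definition is_levi_civita (g : M -> 'M[R]_m) (nabla : connection_op) :=
  [/\ is_connection nabla, torsion_free nabla & metric_compatible g nabla].

Definition is_kahler (g : M -> 'M[R]_m) (nabla : connection_op)
    (P : M -> 'M[R]_m) :=
  [/\ forall (U : set M) X, open U -> smooth_field U X ->
        smooth_field U (fun p => X p *m P p),
      forall p, P p *m P p = - 1%:M,
      forall p u v, ip (g p) (u *m P p) (v *m P p) = ip (g p) u v &
      forall (U : set M) X p v, open U -> U p -> smooth_field U X ->
        nabla p v (fun q => X q *m P q) = nabla p v X *m P p].

(* [E] is an orthonormal frame, over the open set [U], of the subbundle [K] of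
   the tangent bundle. *)
Definition local_onframe (g K : M -> 'M[R]_m) (U : set M) k
    (E : 'I_k -> M -> 'rV[R]_m) :=
  [/\ open U, forall i, smooth_field U (E i) &
      forall p, U p ->
        [/\ \rank (K p) = k,
            forall i, (E i p <= K p)%MS &
            forall i j, ip (g p) (E i p) (E j p) = (i == j)%:R]].

(* The sum over [K] of a quadratic expression [B] in a section of [K]. *)
Definition trace_vanishes {n} (g K : M -> 'M[R]_m)
    (B : (M -> 'rV[R]_m) -> M -> 'rV[R]_n) :=
  forall (U : set M) k (E : 'I_k -> M -> 'rV[R]_m), local_onframe g K U E ->
    forall p, U p -> \sum_i B (E i) p = 0.

Definition totally_geodesic (nabla : connection_op) (A : M -> 'M[R]_m) :=
  forall (W : set M) U V, open W -> smooth_field W U -> smooth_field W V ->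
    (forall q, W q -> (U q <= A q)%MS /\ (V q <= A q)%MS) ->
    forall q, W q -> (nabla q (U q) V <= A q)%MS.

End Riemannian.

Section CovariantDerivativeAlong.
Context {R : realType} {n : nat} {N : manifold R n}.

(* Covariant derivative at [x], in the direction [v], of a vector field [W]
   along a map [G] defined on (a subset of) a normed space:
   D_v (sum_a W^a d_a) = sum_a (v (W^a) d_a + W^a nabla_(G_* v) d_a),
   the d_a being the coordinate fields of the chart at [G x]. *)
Definition cov_along (nabla : connection_op N) {V : normedModType R}
    (G : V -> N) (W : V -> 'rV[R]_n) (x v : V) : 'rV[R]_n :=
  'D_v (fun y => W y *m trans (G y) (G x) (G y)) x
  + nabla (G x) ('D_v (cmap (G x) \o G) x) (const_field (G x) (W x)).

Definition pullback_connection (nabla : connection_op N) {m : nat}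
    {M : manifold R m} (F : M -> N) (p : M) (v : 'rV[R]_m)
    (V : M -> 'rV[R]_n) : 'rV[R]_n :=
  cov_along nabla (F \o cinv p) (V \o cinv p) (cmap p p) v.

Definition velocity (beta : R^o -> N) (t : R^o) : 'rV[R]_n :=
  'D_(1 : R^o) (cmap (beta t) \o beta) t.

Definition smooth_curve (I : set R^o) (beta : R^o -> N) :=
  (forall t, I t -> {for t, continuous beta}) /\
  forall q, smooth_on (I `&` beta @^-1` cdom q) (cmap q \o beta).

Definition geodesic (nabla : connection_op N) (I : set R^o) (beta : R^o -> N) :=
  [/\ open I, is_interval (I : set R), smooth_curve I beta &
      forall t, I t -> cov_along nabla beta (velocity beta) t (1 : R^o) = 0].

(* [A] is the distribution range F_* on N. *)
Definition clairaut (g : N -> 'M[R]_n) (nabla : connection_op N)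
    (A : N -> 'M[R]_n) (s : N -> R) :=
  (forall q, 0 < s q) /\
  forall (I : set R^o) beta, geodesic nabla I beta ->
    let theta t :=
      let q := beta t in
      let V := velocity beta t *m proj_mx (orthcomp (g q) (A q)) (A q) in
      angle (g q) (velocity beta t) V in
    forall t t', I t -> I t' ->
      s (beta t) * sin (theta t) = s (beta t') * sin (theta t').

End CovariantDerivativeAlong.

Section RiemannianMaps.
Context {R : realType} {m n : nat} {M : manifold R m} {N : manifold R n}.
Variables (gM : M -> 'M[R]_m) (gN : N -> 'M[R]_n).
Variables (nablaM : connection_op M) (nablaN : connection_op N).
Variable F : M -> N.

Definition ker_bundle (p : M) : 'M[R]_m := kermx (tangent_map F p).
Definition ker_perp (p : M) : 'M[R]_m := orthcomp (gM p) (ker_bundle p).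
Definition range_bundle (p : M) : 'M[R]_n := <<tangent_map F p>>%MS.
Definition range_perp (p : M) : 'M[R]_n := orthcomp (gN (F p)) (range_bundle p).

Definition range_part (p : M) (v : 'rV[R]_n) : 'rV[R]_n :=
  v *m proj_mx (range_bundle p) (range_perp p).
Definition perp_part (p : M) (v : 'rV[R]_n) : 'rV[R]_n :=
  v *m proj_mx (range_perp p) (range_bundle p).

Definition push (X : M -> 'rV[R]_m) (p : M) : 'rV[R]_n :=
  X p *m tangent_map F p.

Definition riemannian_map :=
  forall p u v, (u <= ker_perp p)%MS -> (v <= ker_perp p)%MS ->
    ip (gN (F p)) (u *m tangent_map F p) (v *m tangent_map F p)
    = ip (gM p) u v.

Definition second_fundamental_form (X Y : M -> 'rV[R]_m) (p : M) : 'rV[R]_n :=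
  pullback_connection nablaN F p (X p) (push Y)
  - nablaM p (X p) Y *m tangent_map F p.

Definition harmonic_map :=
  trace_vanishes gM (fun _ => 1%:M) (fun X => second_fundamental_form X X).

(* The second fundamental form of the fibres is the component in
   (ker F_* )^\perp of nabla^M_U W, for U, W tangent to the fibres. *)
Definition minimal_fibres :=
  trace_vanishes gM ker_bundle (fun U p =>
    nablaM p (U p) U *m proj_mx (ker_perp p) (ker_bundle p)).

Variable P : N -> 'M[R]_n.
Variables D1 D2 : M -> 'M[R]_n.

Definition semi_invariant :=
  [/\ is_subbundle_along F D1, is_subbundle_along F D2 &
      forall p, [/\ (D1 p + D2 p == range_bundle p)%MS,
                    (D2 p <= orthcomp (gN (F p)) (D1 p))%MS,
                    (D1 p *m P (F p) == D1 p)%MS &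
                    (D2 p *m P (F p) <= range_perp p)%MS]].

Definition PD2 (p : M) : 'M[R]_n := D2 p *m P (F p).
Definition eta (p : M) : 'M[R]_n :=
  (range_perp p :&: orthcomp (gN (F p)) (PD2 p))%MS.

(* For u in range F_*, P u lies in D1 + P D2; for v in (range F_* )^\perp,
   P v lies in range F_* + eta. *)
Definition phi (p : M) (u : 'rV[R]_n) : 'rV[R]_n :=
  u *m P (F p) *m proj_mx (D1 p) (PD2 p).
Definition omega (p : M) (u : 'rV[R]_n) : 'rV[R]_n :=
  u *m P (F p) *m proj_mx (PD2 p) (D1 p).
Definition Cpart (p : M) (v : 'rV[R]_n) : 'rV[R]_n :=
  v *m P (F p) *m proj_mx (eta p) (range_bundle p).

Definition shape_op (V : M -> 'rV[R]_n) (X : M -> 'rV[R]_m) (p : M) :=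
  - range_part p (pullback_connection nablaN F p (X p) V).
Definition normal_conn (X : M -> 'rV[R]_m) (V : M -> 'rV[R]_n) (p : M) :=
  perp_part p (pullback_connection nablaN F p (X p) V).

Definition clairaut_trace_term (X : M -> 'rV[R]_m) (p : M) : 'rV[R]_n :=
  let omegaFX q := omega q (push X q) in
  let PphiFX q := phi q (push X q) *m P (F q) in
  omega p (shape_op omegaFX X p)
  - Cpart p (normal_conn X omegaFX p)
  - perp_part p (pullback_connection nablaN F p (X p) PphiFX).

End RiemannianMaps.

(* Main.v *)
From HB Require Import structures.
Require Import Defs.
From mathcomp Require Import all_boot all_order all_algebra.
From mathcomp Require Import all_classical all_reals all_analysis.
From mathcomp Require Import ring.

(* For a semi-invariant F and X in (ker F_* )^\perp, the Kaehler identity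
   nabla^F_X F_*X = - P nabla^F_X (phi F_*X + omega F_*X) turns the expression
   under the trace into the (range F_* )^\perp-part of nabla^F_X F_*X.  For a
   Riemannian map, g_N(B(X, Y), F_*Z), with B the second fundamental form, is
   symmetric in X, Y and skew in Y, Z on (ker F_* )^\perp, hence B(X, X) has no
   range F_*-part there and equals (nabla^F_X F_*X)^\perp.  Finally
   B(U, U) = - F_*(nabla_U U) for U in ker F_*, so that minimality of the fibres
   reduces the trace of B over TM to the trace over (ker F_* )^\perp; there the
   trace may be computed in a frame adapted to TM = (ker F_* )^\perp + ker F_*,
   because B is tensorial. *)

Set Implicit Arguments.
Unset Strict Implicit.
Unset Printing Implicit Defensive.

Import Order.TTheory GRing.Theory Num.Theory.
Import numFieldNormedType.Exports.

Local Open Scope classical_set_scope.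
Local Open Scope ring_scope.

(** * Functions of class C^k *)

(** Both traces range over all local orthonormal frames, so each implication has to produce frames
    through a given point. Constant rank of [F] gives [ker_perp] and [ker_bundle] constant rank, and
    Gram-Schmidt applied to smooth sections that span at one point then yields a frame nearby. The
    other obstacle is regularity. The axioms of a connection speak only of smooth fields on open
    sets, whereas [phi] and [omega] are pointwise projections [proj_mx] with no visible regularity.
    The covariant derivative along [F] is of first order, so its rules hold as soon as the fields
    are differentiable at the point of evaluation ([diff_along]). For [phi] this comes from writing
    the orthogonal projection onto [D1] in a local frame, through the inverse Gram matrix. Metric
    compatibility and parallelism of [P] along [F] are reduced by Leibniz rules to coordinate fields
    of [N], where they are the hypotheses on [N] composed with [F]. *)

Section ScaleDiff.
Context {R : realType}.

(** With scaling registered as a bilinear map, [differentiable_bilin] and [diff_bilin] yield the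
    product rule for a scalar function times a vector-valued one. *)
Lemma scale_is_bilinear (W : normedModType R) :
  bilinear_for
    (GRing.Scale.Law.clone _ _ *:%R _) (GRing.Scale.Law.clone _ _ *:%R _)
    (@GRing.scale R W : R^o -> W -> W).
Proof.
split=> [u'|u] a x y /=.
- by rewrite scalerDl scalerA.
- by rewrite scalerDr !scalerA mulrC.
Qed.
HB.instance Definition _ (W : normedModType R) :=
  bilinear_isBilinear.Build R R^o W W _ _ (@GRing.scale R W : R^o -> W -> W)
  (@scale_is_bilinear W).

Context {V W : normedModType R}.
Implicit Types (h : V -> R^o) (f : V -> W).

Lemma is_diff_scale_fun h f x :
  differentiable h x -> differentiable f x ->
  is_diff x (fun y => h y *: f y)
    (fun v => 'd h x v *: f x + h x *: 'd f x v).
Proof.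
move=> dh df.
have scale_cont : continuous (fun q : R^o * W => q.1 *: q.2).
  by move=> p; apply: scale_continuous.
have -> : (fun y => h y *: f y) =
    (fun q : R^o * W => (@GRing.scale R W : R^o -> W -> W) q.1 q.2)
      \o (fun y => (h y, f y)) by [].
have dp := differentiable_pair dh df.
apply: DiffDef.
  by apply: differentiable_comp => //; exact: differentiable_bilin.
rewrite diff_comp//; last exact: differentiable_bilin.
by rewrite diff_bilin// diff_pair//; apply/funext => v /=; rewrite addrC.
Qed.

Lemma differentiable_scale_fun h f x :
  differentiable h x -> differentiable f x ->
  differentiable (fun y => h y *: f y) x.
Proof. by move=> dh df; have [] := is_diff_scale_fun dh df. Qed.

Lemma derive_scale_fun h f x v :
  differentiable h x -> differentiable f x ->
  'D_v (fun y => h y *: f y) x = 'D_v h x *: f x + h x *: 'D_v f x.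
Proof.
move=> dh df; rewrite deriveE; last exact: differentiable_scale_fun.
have ? := is_diff_scale_fun dh df.
by rewrite diff_val !deriveE.
Qed.
End ScaleDiff.

Section CkCalculus.
Context {R : realType} {V : normedModType R}.
Implicit Types (A : set V) (W : normedModType R).

(** The little-o expansion at [x] depends only on the germ, so [g] inherits it with the linear part
    of [f]; [diff_unique] identifies that part with the differential of [g]. *)
Lemma near_eq_differentiable W (f g : V -> W) x :
  (\near x, f x = g x) -> differentiable f x -> differentiable g x.
Proof.
move=> fg df; have fgx : f x = g x := nbhs_singleton fg.
have /diff_locallyP[cf Hf] := df.
have Hg : g \o shift x = cst (g x) + 'd f x +o_ 0 id.
  apply/eqaddoP => e e0; have /eqaddoP/(_ _ e0) := Hf.
  have fg0 : \forall y \near (0 : V), f (y + x) = g (y + x).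
    by move: fg; rewrite (near_shift 0) subr0.
  move=> He; near=> y.
  have : (f \o shift x) y = (g \o shift x) y by rewrite /=; near: y.
  by rewrite !fctE /= -fgx => <-; near: y.
by apply/diff_locallyP; rewrite (diff_unique cf Hg).
Unshelve. all: by end_near. Qed.

Lemma open_near_eq W A (f g : V -> W) x : open A -> (forall y, A y -> f y = g y) ->
  A x -> \near x, f x = g x.
Proof.
move=> oA fg Ax; apply: filterS fg _; exact: open_nbhs_nbhs.
Qed.

(** Openness of [A] is what makes pointwise equality on [A] an equality of germs, hence of limits
    and derivatives. *)
Lemma Ck_on_ext W k A (f g : V -> W) : open A -> (forall x, A x -> f x = g x) ->
  Ck_on k A f -> Ck_on k A g.
Proof.
move=> oA; elim: k f g => [|k IHk] f g fg /=.
  move=> cf x Ax; have xfg := open_near_eq oA fg Ax.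
  rewrite /prop_for /continuous_at -(fg _ Ax).
  apply: cvg_trans (cf x Ax : f @ x --> f x); exact: near_eq_cvg.
move=> [df Df]; split=> [x Ax|v].
  by apply: near_eq_differentiable (df x Ax); exact: open_near_eq Ax.
apply: IHk (Df v) => x Ax; apply: near_eq_derive; exact: open_near_eq Ax.
Qed.

Lemma Ck_onW W k A (f : V -> W) : Ck_on k.+1 A f -> Ck_on k A f.
Proof.
elim: k f => [|k IHk] f [df Df].
  by move=> x Ax; exact/differentiable_continuous/df.
by split=> // v; apply: IHk.
Qed.

Lemma Ck_on_sub W k A B (f : V -> W) : B `<=` A -> Ck_on k A f -> Ck_on k B f.
Proof.
move=> BA; elim: k f => [|k IHk] f /=; first by move=> cf x /BA/cf.
by move=> [df Df]; split=> [x /BA/df//|v]; apply: IHk.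
Qed.

Lemma Ck_on_cst W k A (a : W) : Ck_on k A (fun _ => a).
Proof.
elim: k a => [|k IHk] a /=; first by move=> x _; exact: cst_continuous.
split=> [x _|v]; first exact: differentiable_cst.
have -> : (fun x => 'D_v (fun _ : V => a) x) = (fun _ => 0).
  by apply/funext => x; exact: derive_cst.
exact: IHk.
Qed.

Lemma Ck_onD W k A (f g : V -> W) : open A ->
  Ck_on k A f -> Ck_on k A g -> Ck_on k A (fun x => f x + g x).
Proof.
move=> oA; elim: k f g => [|k IHk] f g /=.
  by move=> cf cg x Ax; apply: continuousD; [exact: cf|exact: cg].
move=> [df Df] [dg Dg]; split=> [x Ax|v].
  by apply: differentiableD; [exact: df|exact: dg].
apply: (Ck_on_ext oA _ (IHk _ _ (Df v) (Dg v))) => x Ax.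
by rewrite -deriveD//; apply: diff_derivable; [exact: df|exact: dg].
Qed.

Lemma Ck_on_scale W k A (h : V -> R^o) (f : V -> W) : open A ->
  Ck_on k A h -> Ck_on k A f -> Ck_on k A (fun x => h x *: f x).
Proof.
move=> oA; elim: k h f => [|k IHk] h f.
  move=> ch cf x Ax.
  have := cvgZ (ch x Ax : h @ x --> h x) (cf x Ax : f @ x --> f x); exact.
move=> Ch Cf; have [dh Dh] := Ch; have [df Df] := Cf; split=> [x Ax|v].
  by apply: differentiable_scale_fun; [exact: dh|exact: df].
have : Ck_on k A (fun x => 'D_v h x *: f x + h x *: 'D_v f x).
  apply: Ck_onD => //; first exact: IHk (Dh v) (Ck_onW Cf).
  exact: IHk (Ck_onW Ch) (Df v).
apply: Ck_on_ext => // x Ax.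
by rewrite derive_scale_fun//; [exact: dh|exact: df].
Qed.

Lemma Ck_on_sum W k A n (f : 'I_n -> V -> W) : open A ->
  (forall i, Ck_on k A (f i)) -> Ck_on k A (fun x => \sum_i f i x).
Proof.
move=> oA; elim: n f => [|n IHn] f Cf.
  apply: (Ck_on_ext oA _ (@Ck_on_cst W k A 0)) => x _; by rewrite big_ord0.
apply: (@Ck_on_ext W k A (fun x => f ord0 x + \sum_(i < n) f (lift ord0 i) x)) => //.
  by move=> x _; rewrite big_ord_recl.
by apply: Ck_onD => //; exact: IHn.
Qed.

Lemma derive_row n (f : V -> 'rV[R]_n) x v i : differentiable f x ->
  'D_v (fun y => f y 0 i : R^o) x = ('D_v f x) 0 i.
Proof. by move=> df; rewrite derive_mx ?mxE//; exact: diff_derivable. Qed.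

Lemma differentiable_row n (f : V -> 'rV[R]_n) x i : differentiable f x ->
  differentiable (fun y => f y 0 i : R^o) x.
Proof.
move=> df; apply: (@differentiable_comp _ _ _ _ f (fun M : 'rV[R]_n => M 0 i : R^o)) => //.
exact: differentiable_coord.
Qed.

Lemma Ck_on_row n k A (f : V -> 'rV[R]_n) i : open A ->
  Ck_on k A f -> Ck_on k A (fun x => f x 0 i : R^o).
Proof.
move=> oA; elim: k f => [|k IHk] f /=.
  move=> cf x Ax; apply: (@continuous_comp _ _ _ f (fun M : 'rV[R]_n => M 0 i : R^o)).
    exact: cf.
  exact: coord_continuous.
move=> [df Df]; split=> [x Ax|v]; first by apply: differentiable_row; exact: df.
apply: (Ck_on_ext oA _ (IHk _ (Df v))) => x Ax.
by rewrite derive_row//; exact: df.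
Qed.

Lemma derive_comp_row n W (g : 'rV[R]_n -> W) (f : V -> 'rV[R]_n) x v :
  differentiable f x -> differentiable g (f x) ->
  'D_v (g \o f) x = 'D_('D_v f x) g (f x).
Proof.
move=> df dg; rewrite !deriveE//; last exact: differentiable_comp.
by rewrite diff_comp.
Qed.

Lemma derive_sum_delta n W (g : 'rV[R]_n -> W) x v : differentiable g x ->
  'D_v g x = \sum_i v 0 i *: 'D_(delta_mx 0 i) g x.
Proof.
move=> dg; rewrite deriveE// {1}(row_sum_delta v) linear_sum.
by apply: eq_bigr => i _; rewrite linearZ deriveE.
Qed.

(** The chain rule differentiates [g] in the moving direction ['D_v f x]; expanding that direction
    in the standard basis leaves derivatives of [g] in fixed directions, to which the induction
    hypothesis applies. *)
Lemma Ck_on_comp n W k A (B : set 'rV[R]_n) (g : 'rV[R]_n -> W)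
  (f : V -> 'rV[R]_n) : open A -> (forall x, A x -> B (f x)) ->
  Ck_on k B g -> Ck_on k A f -> Ck_on k A (g \o f).
Proof.
move=> oA AB; elim: k g => [|k IHk] g.
  move=> cg cf x Ax; apply: continuous_comp; first exact: cf.
  exact/cg/AB.
move=> Cg Cf; have [dg Dg] := Cg; have [df Df] := Cf; split=> [x Ax|v].
  by apply: differentiable_comp; [exact: df|exact/dg/AB].
apply: (@Ck_on_ext _ k A (fun x =>
  \sum_i ('D_v f x 0 i : R^o) *: 'D_(delta_mx 0 i) g (f x))) => //.
  move=> x Ax; rewrite derive_comp_row//; [|exact: df|exact/dg/AB].
  by rewrite -derive_sum_delta//; exact/dg/AB.
apply: Ck_on_sum => // i; apply: Ck_on_scale => //; first exact: Ck_on_row (Df v).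
exact: IHk (Dg _) (Ck_onW Cf).
Qed.

(** This serves to normalise vectors smoothly in Gram-Schmidt. The induction closes because the
    derivative of y^(-1/2) is -1/2 times the cube of the function itself. *)
Lemma Ck_on_invsqrt k A (h : V -> R^o) : open A -> (forall x, A x -> 0 < h x) ->
  Ck_on k A h -> Ck_on k A (fun x => (Num.sqrt (h x))^-1 : R^o).
Proof.
move=> oA h0.
pose s (y : R^o) : R^o := (Num.sqrt y)^-1.
have ds y : 0 < y -> is_derive (y : R^o) 1 s (- 2^-1 * (s y) ^+ 3).
  move=> y0; have sy0 : Num.sqrt y != 0 by rewrite gt_eqF// sqrtr_gt0.
  have Hs := is_derive1_sqrt y0.
  apply: is_derive_eq; first exact: (is_deriveV sy0).
  by rewrite /s /GRing.scale /=; field.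
have dsh x : A x -> differentiable h x -> differentiable (s \o h) x.
  move=> Ax dh; apply: differentiable_comp => //.
  by apply/derivable1_diffP; have [] := ds _ (h0 _ Ax).
elim: k => [|k IHk].
  move=> ch x Ax; apply: (@continuous_comp _ _ _ h s); first exact: ch.
  apply: differentiable_continuous; apply/derivable1_diffP.
  by have [] := ds _ (h0 _ Ax).
move=> Ch; have [dh Dh] := Ch; split=> [x Ax|v].
  by apply: dsh => //; exact: dh.
have Cs := IHk (Ck_onW Ch).
apply: (@Ck_on_ext _ k A (fun x =>
  (- 2^-1 : R^o) *: (s (h x) *: (s (h x) *: (s (h x) *: 'D_v h x))))) => //.
  move=> x Ax.
  have dhx := dh _ Ax.
  have dsx : differentiable s (h x).
    by apply/derivable1_diffP; have [] := ds _ (h0 _ Ax).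
  rewrite -[RHS]/('D_v (s \o h) x) [RHS]deriveE; last exact: dsh Ax dhx.
  have E : 'd s (h x) ('d h x v) = 'D_v h x *: 'd s (h x) 1.
    by rewrite (deriveE v dhx) -linearZ /GRing.scale /= mulr1.
  rewrite diff_comp//= E -(deriveE (1 : R^o) dsx).
  have [_ ->] := ds _ (h0 _ Ax).
  by rewrite /GRing.scale /=; ring.
apply: Ck_on_scale => //; first exact: Ck_on_cst.
do 3 (apply: Ck_on_scale; [exact: oA|exact: Cs|]).
exact: Dh.
Qed.
End CkCalculus.

(** * Charts and smooth functions *)

Lemma eq_mulmx_row (R : realType) m n (A B : 'M[R]_(m, n)) :
  (forall u : 'rV_m, u *m A = u *m B) -> A = B.
Proof. by move=> AB; apply/row_matrixP => i; rewrite !rowE. Qed.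

Lemma jacobian_comp (R : realType) m n k (f : 'rV[R]_m -> 'rV[R]_n)
    (g : 'rV[R]_n -> 'rV[R]_k) x :
  differentiable f x -> differentiable g (f x) ->
  jacobian (g \o f) x = jacobian f x *m jacobian g (f x).
Proof.
move=> df dg; apply: eq_mulmx_row => u.
have dgf := differentiable_comp df dg.
apply: etrans (esym (deriveEjacobian u dgf)) _.
by rewrite derive_comp_row// mulmxA (deriveEjacobian u df) (deriveEjacobian _ dg).
Qed.

Lemma smooth_on_diff (R : realType) (V W : normedModType R) A (f : V -> W) x :
  smooth_on A f -> A x -> differentiable f x.
Proof. by move=> /(_ 1%N)[df _]; exact: df. Qed.

Lemma smooth_on_derive (R : realType) (V W : normedModType R) A (f : V -> W) v :
  smooth_on A f -> smooth_on A ('D_v f).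
Proof. by move=> sf k; have [_ ] := sf k.+1; exact. Qed.

Lemma smooth_on_ext (R : realType) (V W : normedModType R) A (f g : V -> W) :
  open A -> (forall x, A x -> f x = g x) -> smooth_on A f -> smooth_on A g.
Proof. by move=> oA fg sf k; exact: Ck_on_ext fg (sf k). Qed.

Lemma smooth_on_sub (R : realType) (V W : normedModType R) A B (f : V -> W) :
  B `<=` A -> smooth_on A f -> smooth_on B f.
Proof. by move=> BA sf k; exact: Ck_on_sub (sf k). Qed.

Section Charts.
Context {R : realType} {m : nat} {M : manifold R m}.
Implicit Types (U : set M) (p q x : M).

Lemma open_cdom p : open (cdom p).
Proof. exact: chart_dom_open. Qed.

Lemma mem_cdom p : cdom p p.
Proof. exact: mem_chart_at. Qed.

Lemma cmapK p x : cdom p x -> cinv p (cmap p x) = x.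
Proof. exact: chart_mapK. Qed.

Lemma near_cinv p x U : cdom p x -> nbhs x U ->
  \forall y \near cmap p x, U (cinv p y).
Proof.
move=> px xU; have := chart_inv_cont px.
by rewrite /prop_for /continuous_at chart_mapK//; exact.
Qed.

Lemma cmap_image_open p U : open U -> open (cmap p @` (cdom p `&` U)).
Proof.
move=> oU; rewrite openE => _ [x [px Ux] <-].
rewrite /interior.
have h1 : \forall y \near cmap p x, (cmap p @` cdom p) y.
  by apply: open_nbhs_nbhs; split; [exact: chart_im_open|exists x].
have h2 : \forall y \near cmap p x, U (cinv p y).
  by apply: near_cinv => //; exact: open_nbhs_nbhs.
near=> y.
have [z pz zy] : (cmap p @` cdom p) y by near: y.
exists z => //; split=> //.
by rewrite -(cmapK pz) zy; near: y.
Unshelve. all: by end_near. Qed.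

Lemma trans_diff p q x : cdom p x -> cdom q x ->
  differentiable (cmap q \o cinv p) (cmap p x).
Proof.
by move=> px qx; apply: (smooth_on_diff (chart_compat (m:=m) p q)); exists x.
Qed.

Lemma near_chart_eq p q x : cdom p x -> cdom q x ->
  \forall y \near cmap p x, cinv q (cmap q (cinv p y)) = cinv p y.
Proof.
move=> px qx.
have : \forall y \near cmap p x, cdom q (cinv p y).
  by apply: near_cinv => //; apply: open_nbhs_nbhs; split=> //; exact: open_cdom.
by apply: filterS => y /cmapK.
Qed.

Lemma jacobian_near_eq (n k : nat) (f g : 'rV[R]_n -> 'rV[R]_k) (x : 'rV[R]_n) :
  differentiable f x -> (\near x, f x = g x) -> jacobian f x = jacobian g x.
Proof.
move=> df fg; apply: eq_mulmx_row => u.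
have dg := near_eq_differentiable fg df.
apply: etrans (esym (deriveEjacobian u df)) _.
apply: etrans (deriveEjacobian u dg).
exact: near_eq_derive.
Qed.

(** Chain rule for transition maps. The composite through the chart at [q] agrees with the direct
    transition only near the point, so the jacobians are compared through germs. *)
Lemma trans_comp p q s x : cdom p x -> cdom q x -> cdom s x ->
  trans p q x *m trans q s x = trans p s x.
Proof.
move=> px qx sx.
have E : (cmap q \o cinv p) (cmap p x) = cmap q x by rewrite /= cmapK.
rewrite /trans -[in jacobian _ (cmap q x)]E -jacobian_comp ?E; last 2 first.
- exact: trans_diff.
- exact: trans_diff.
apply: jacobian_near_eq.
  by apply: differentiable_comp; [exact: trans_diff|rewrite E; exact: trans_diff].
by apply: filterS (near_chart_eq px qx) => y /= ->.
Qed.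

Lemma near_cmapK p x : cdom p x -> \forall y \near cmap p x, cmap p (cinv p y) = y.
Proof.
move=> px.
have : \forall y \near cmap p x, (cmap p @` cdom p) y.
  by apply: open_nbhs_nbhs; split; [exact: chart_im_open|exists x].
by apply: filterS => y [z pz <-]; rewrite cmapK.
Qed.

Lemma jacobian_id n (x : 'rV[R]_n) : jacobian id x = 1%:M.
Proof.
apply: eq_mulmx_row => u.
by rewrite -deriveEjacobian ?mulmx1 ?derive_id//; have [] := is_diff_id x.
Qed.

Lemma trans_id p x : cdom p x -> trans p p x = 1%:M.
Proof.
move=> px; rewrite -(jacobian_id (cmap p x)); apply: jacobian_near_eq.
  exact: trans_diff.
exact: near_cmapK.
Qed.

Lemma transK p q x : cdom p x -> cdom q x -> trans p q x *m trans q p x = 1%:M.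
Proof. by move=> px qx; rewrite trans_comp// trans_id. Qed.

(** [smooth_fun] is the case [W = R^o]; other targets are needed for the component vectors of a
    field in a fixed chart. *)
Definition smoothM {W : normedModType R} U (h : M -> W) :=
  forall p, smooth_on (cmap p @` (cdom p `&` U)) (h \o cinv p).

Section SmoothM.
Context {W : normedModType R}.
Implicit Types (h f g : M -> W).

Lemma smoothM_ext U f g : open U -> (forall x, U x -> f x = g x) ->
  smoothM U f -> smoothM U g.
Proof.
move=> oU fg sf p; apply: smooth_on_ext (sf p); first exact: cmap_image_open.
by move=> _ [x [px Ux] <-] /=; rewrite cmapK// fg.
Qed.

Lemma smoothM_sub U U' h : U' `<=` U -> smoothM U h -> smoothM U' h.
Proof.
move=> UU' sh p; apply: smooth_on_sub (sh p).
by apply: image_subset; exact: setIS.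
Qed.

Lemma smoothM_cst U (a : W) : smoothM U (fun _ => a).
Proof. by move=> p k; exact: Ck_on_cst. Qed.

Lemma smoothMD U f g : open U -> smoothM U f -> smoothM U g ->
  smoothM U (fun x => f x + g x).
Proof.
move=> oU sf sg p k; apply: (Ck_onD _ (sf p k) (sg p k)).
exact: cmap_image_open.
Qed.

Lemma smoothM_scale U (h : M -> R^o) f : open U -> smoothM U h -> smoothM U f ->
  smoothM U (fun x => h x *: f x).
Proof.
move=> oU sh sf p k; apply: (Ck_on_scale _ (sh p k) (sf p k)).
exact: cmap_image_open.
Qed.

Lemma smoothM_continuous U h x : open U -> smoothM U h -> U x ->
  {for x, continuous h}.
Proof.
move=> oU sh Ux.
have : {for cmap x x, continuous (h \o cinv x)}.
  by apply: (sh x 0%N); exists x => //; split=> //; exact: mem_cdom.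
move=> ch.
have cx : {for x, continuous (cmap x)} := chart_map_cont (mem_cdom x).
have := continuous_comp cx ch.
rewrite /prop_for /continuous_at /= cmapK; last exact: mem_cdom.
apply: cvg_trans; apply: near_eq_cvg.
have : \forall y \near x, cdom x y.
  by apply: open_nbhs_nbhs; split; [exact: open_cdom|exact: mem_cdom].
by apply: filterS => y xy /=; rewrite cmapK.
Qed.

Lemma smoothM_diff U h p x : smoothM U h -> cdom p x -> U x ->
  differentiable (h \o cinv p) (cmap p x).
Proof. by move=> sh px Ux; apply: smooth_on_diff (sh p) _; exists x. Qed.

End SmoothM.

Lemma smoothM_row n U (h : M -> 'rV[R]_n) i : open U -> smoothM U h ->
  smoothM U (fun x => h x 0 i : R^o).
Proof.
move=> oU sh p k; apply: (@Ck_on_row _ _ n k _ (h \o cinv p)).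
  exact: cmap_image_open.
exact: sh.
Qed.

Lemma smoothM_invsqrt U (h : M -> R^o) : open U -> (forall x, U x -> 0 < h x) ->
  smoothM U h -> smoothM U (fun x => (Num.sqrt (h x))^-1 : R^o).
Proof.
move=> oU h0 sh p k.
apply: (@Ck_on_invsqrt _ _ k _ (h \o cinv p)).
- exact: cmap_image_open.
- by move=> _ [x [px Ux] <-] /=; rewrite cmapK//; exact: h0.
- exact: sh.
Qed.

Lemma smoothM_gt0 U (h : M -> R^o) x : open U -> smoothM U h -> U x -> 0 < h x ->
  exists V : set M, [/\ open V, V x, V `<=` U & forall y, V y -> 0 < h y].
Proof.
move=> oU sh Ux hx.
have ch := smoothM_continuous oU sh Ux.
have : nbhs x [set y | U y /\ 0 < h y].
  apply: filterI; first exact: open_nbhs_nbhs.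
  exact: (cvgr_gt (h x) ch).
rewrite nbhsE => -[V [oV Vx] VU]; exists V; split=> // y /VU[]//.
Qed.

(** The function is a directional derivative of the smooth transition map, read off at
    [cmap p x]. *)
Lemma smoothM_trans p q (u : 'rV[R]_m) :
  smoothM (cdom p `&` cdom q) (fun x => u *m trans p q x).
Proof.
move=> s k.
have oA : open (cmap s @` (cdom s `&` (cdom p `&` cdom q))).
  by apply: cmap_image_open; apply: openI; exact: open_cdom.
apply: (@Ck_on_ext _ _ _ k _
  (('D_u (cmap q \o cinv p)) \o (cmap p \o cinv s))) => //.
  move=> _ [x [sx [px qx]] <-] /=; rewrite cmapK//.
  by rewrite deriveEjacobian//; exact: trans_diff.
have sD := smooth_on_derive u (chart_compat (m:=m) p q).
apply: (Ck_on_comp _ _ (sD k)) => //.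
  by move=> _ [x [sx [px qx]] <-] /=; rewrite cmapK//; exists x.
apply: Ck_on_sub (chart_compat (m:=m) s p k).
by apply: image_subset => x [sx [px _]].
Qed.

Lemma dfun_chart h p q v : cdom p q -> differentiable (h \o cinv p : _ -> R^o) (cmap p q) ->
  dfun h q v = 'D_(v *m trans q p q) (h \o cinv p : _ -> R^o) (cmap p q).
Proof.
move=> pq dh; have qq := mem_cdom q.
rewrite -[in RHS]deriveEjacobian; last exact: trans_diff.
have E : (cmap p \o cinv q) (cmap q q) = cmap p q by rewrite /= cmapK.
rewrite -[in RHS]E -derive_comp_row ?E//; last exact: trans_diff.
apply: near_eq_derive.
by apply: filterS (near_chart_eq qq pq) => y /= ->.
Qed.

End Charts.

(** * Vector fields and connections *)

Section Fields.
Context {R : realType} {m : nat} {M : manifold R m}.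
Implicit Types (U : set M) (p q x : M) (X Y Z : M -> 'rV[R]_m) (h : M -> R^o).

Lemma smooth_fieldP U Y : smooth_field U Y <->
  forall q, smoothM (U `&` cdom q) (fun x => Y x *m trans x q x).
Proof.
split=> sY.
  by move=> q p; rewrite setIA; exact: sY.
by move=> p q; have := sY q p; rewrite setIA.
Qed.

Lemma smooth_field_ext U Y Z : open U -> (forall x, U x -> Y x = Z x) ->
  smooth_field U Y -> smooth_field U Z.
Proof.
move=> oU YZ /smooth_fieldP sY; apply/smooth_fieldP => q.
apply: smoothM_ext (sY q); first by apply: openI => //; exact: open_cdom.
by move=> x [Ux _]; rewrite YZ.
Qed.

Lemma smooth_field_sub U V Y : V `<=` U -> smooth_field U Y -> smooth_field V Y.
Proof.
move=> VU /smooth_fieldP sY; apply/smooth_fieldP => q.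
by apply: smoothM_sub (sY q); exact: setSI.
Qed.

Lemma smooth_field0 U : smooth_field U (fun _ => 0 : 'rV[R]_m).
Proof.
apply/smooth_fieldP => q.
have -> : (fun x => 0 *m trans x q x) = (fun _ => 0 : 'rV[R]_m).
  by apply/funext => x; rewrite mul0mx.
exact: smoothM_cst.
Qed.

Lemma smooth_fieldD U Y Z : open U -> smooth_field U Y -> smooth_field U Z ->
  smooth_field U (fun x => Y x + Z x).
Proof.
move=> oU /smooth_fieldP sY /smooth_fieldP sZ; apply/smooth_fieldP => q.
have -> : (fun x => (Y x + Z x) *m trans x q x) =
    (fun x => Y x *m trans x q x + Z x *m trans x q x).
  by apply/funext => x; rewrite mulmxDl.
by apply: smoothMD => //; apply: openI => //; exact: open_cdom.
Qed.

Lemma smooth_field_scale U h Y : open U -> smooth_fun U h -> smooth_field U Y ->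
  smooth_field U (fun x => h x *: Y x).
Proof.
move=> oU sh /smooth_fieldP sY; apply/smooth_fieldP => q.
have -> : (fun x => (h x *: Y x) *m trans x q x) =
    (fun x => h x *: (Y x *m trans x q x)).
  by apply/funext => x; rewrite scalemxAl.
apply: smoothM_scale => //; first by apply: openI => //; exact: open_cdom.
by apply: smoothM_sub sh; exact: subIsetl.
Qed.

Lemma smooth_field_sum U n (Y : 'I_n -> M -> 'rV[R]_m) : open U ->
  (forall i, smooth_field U (Y i)) -> smooth_field U (fun x => \sum_i Y i x).
Proof.
move=> oU; elim: n Y => [|n IHn] Y sY.
  apply: (smooth_field_ext oU _ (@smooth_field0 U)) => x _.
  by rewrite big_ord0.
apply: (@smooth_field_ext _ (fun x => Y ord0 x + \sum_(i < n) Y (lift ord0 i) x)) => //.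
  by move=> x _; rewrite big_ord_recl.
by apply: smooth_fieldD => //; exact: IHn.
Qed.

Lemma smooth_const_field p (u : 'rV[R]_m) : smooth_field (cdom p) (const_field p u).
Proof.
apply/smooth_fieldP => q.
apply: smoothM_ext (smoothM_trans p q u).
  by apply: openI; exact: open_cdom.
move=> x [px qx]; rewrite /const_field -mulmxA trans_comp//; exact: mem_cdom.
Qed.

Lemma const_field_id p (u : 'rV[R]_m) : const_field p u p = u.
Proof. by rewrite /const_field trans_id ?mulmx1//; exact: mem_cdom. Qed.

Lemma field_const_sum p x Y : cdom p x ->
  Y x = \sum_i (Y x *m trans x p x) 0 i *: const_field p (delta_mx 0 i) x.
Proof.
move=> px; rewrite /const_field.
under eq_bigr do rewrite scalemxAl.
rewrite -mulmx_suml -row_sum_delta -mulmxA transK ?mulmx1//; exact: mem_cdom.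
Qed.

Lemma dfun_near h g p v : (\near p, h p = g p) -> dfun h p v = dfun g p v.
Proof.
move=> hg; apply: near_eq_derive.
exact: (near_cinv (mem_cdom p) hg).
Qed.

Lemma dfun_cst (a : R) p v : dfun (fun _ : M => a) p v = 0.
Proof. exact: derive_cst. Qed.

Definition dfunable h p := differentiable (h \o cinv p) (cmap p p).

Lemma smooth_dfunable U h p : smooth_fun U h -> U p -> dfunable h p.
Proof. by move=> sh Up; apply: smoothM_diff sh _ Up; exact: mem_cdom. Qed.

Lemma dfunM h g p v : dfunable h p -> dfunable g p ->
  dfun (fun x => h x * g x) p v = dfun h p v * g p + h p * dfun g p v.
Proof.
move=> dh dg; rewrite /dfun.
have := @derive_scale_fun _ _ _ _ _ _ v dh dg.
by rewrite /= cmapK//; exact: mem_cdom.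
Qed.

Lemma dfunableM h g p : dfunable h p -> dfunable g p ->
  dfunable (fun x => h x * g x : R^o) p.
Proof. exact: (@differentiable_scale_fun _ _ _ (h \o cinv p) (g \o cinv p)). Qed.

Lemma dfunD h g p v : dfunable h p -> dfunable g p ->
  dfun (fun x => h x + g x) p v = dfun h p v + dfun g p v.
Proof.
by move=> dh dg; rewrite /dfun -deriveD//; exact: diff_derivable.
Qed.

Lemma dfunableD h g p : dfunable h p -> dfunable g p ->
  dfunable (fun x => h x + g x : R^o) p.
Proof. exact: differentiableD. Qed.

Lemma dfunable_near h g p : (\near p, h p = g p) -> dfunable h p -> dfunable g p.
Proof.
move=> hg; apply: near_eq_differentiable.
exact: (near_cinv (mem_cdom p) hg).
Qed.

Lemma dfunB h p u v : dfunable h p -> dfun h p (u - v) = dfun h p u - dfun h p v.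
Proof. by move=> dh; rewrite /dfun !deriveE// linearB. Qed.

Lemma open_near p U (P : M -> Prop) : open U -> U p -> (forall x, U x -> P x) ->
  \near p, P p.
Proof.
by move=> oU Up UP; apply: (filterS (UP : U `<=` P)); exact: open_nbhs_nbhs.
Qed.

(** [dfun] at [x] is computed in the chart at [x], which varies with the point. By [dfun_chart] the
    function is a sum of components of [Y] times partial derivatives of [h] in the one chart at
    [p]. *)
Lemma smooth_field_dfun U h Y : open U -> smooth_fun U h -> smooth_field U Y ->
  smooth_fun U (fun x => dfun h x (Y x)).
Proof.
move=> oU sh /smooth_fieldP sY p.
have oUp : open (cmap p @` (cdom p `&` U)) by exact: cmap_image_open.
have sYp : smooth_on (cmap p @` (cdom p `&` U))
   ((fun x => Y x *m trans x p x) \o cinv p).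
  apply: smooth_on_sub (sY p p).
  by apply: image_subset => x [px Ux].
move=> k.
apply: (@Ck_on_ext _ _ _ k _ (fun y => \sum_i
  (((fun x => Y x *m trans x p x) \o cinv p) y 0 i : R^o) *:
    'D_(delta_mx 0 i) (h \o cinv p : _ -> R^o) y)) => //.
  move=> _ [x [px Ux] <-].
  have dh := smoothM_diff sh px Ux.
  by rewrite -derive_sum_delta//= cmapK// (dfun_chart _ px dh).
apply: Ck_on_sum => // i; apply: Ck_on_scale => //.
  by apply: Ck_on_row => //; exact: sYp.
exact: (smooth_on_derive _ (sh p)).
Qed.

Definition coordf p (i : 'I_m) : M -> R := fun x => cmap p x 0 i.

Lemma smooth_coordf p i : smooth_fun (cdom p) (coordf p i).
Proof.
move=> q k; apply: (@Ck_on_row _ _ m k _ (cmap p \o cinv q)).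
  exact/cmap_image_open/open_cdom.
exact: (chart_compat (m:=m) q p).
Qed.

Lemma dfun_coordf p x i v : cdom p x -> dfun (coordf p i) x v = (v *m trans x p x) 0 i.
Proof.
move=> px; rewrite /dfun.
have dt := trans_diff (mem_cdom x) px.
by rewrite (@derive_row _ _ _ (cmap p \o cinv x))// deriveEjacobian.
Qed.

(** Torsion-freeness is given only through derivations of functions; testing on the coordinates
    recovers an equality of tangent vectors. *)
Lemma dfun_coordf_ext p u v : (forall i, dfun (coordf p i) p u = dfun (coordf p i) p v) ->
  u = v.
Proof.
move=> uv; apply/rowP => i; have := uv i.
by rewrite !dfun_coordf ?trans_id ?mulmx1//; exact: mem_cdom.
Qed.

End Fields.

(** * Locality of a connection and its values on coordinate fields *)

Section Nabla.
Context {R : realType} {m : nat} {M : manifold R m}.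
Variable nabla : connection_op M.
Hypothesis cn : is_connection nabla.
Implicit Types (U : set M) (p q x : M) (X Y Z : M -> 'rV[R]_m) (h : M -> R^o).

Lemma nabla_dir U p a u v Y : open U -> U p -> smooth_field U Y ->
  nabla p (a *: u + v) Y = a *: nabla p u Y + nabla p v Y.
Proof. by case: cn => + _ _ _; apply. Qed.

Lemma nablaD U p v Y Z : open U -> U p -> smooth_field U Y -> smooth_field U Z ->
  nabla p v (fun q => Y q + Z q) = nabla p v Y + nabla p v Z.
Proof. by case: cn => _ + _ _; apply. Qed.

Lemma nabla_scale U p v h Y : open U -> U p -> smooth_fun U h -> smooth_field U Y ->
  nabla p v (fun q => h q *: Y q) = dfun h p v *: Y p + h p *: nabla p v Y.
Proof. by case: cn => _ _ + _; apply. Qed.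

(** A function [h] equal to 0 on [U] and 1 elsewhere takes the place of a bump function. It may jump
    at the boundary, because smoothness is asked on [U] only. The difference [W] vanishes on [U], so
    [W] equals [h] times [W] everywhere, and the Leibniz rule at [p] gives 0. *)
Lemma nabla_near U p v Y Z : open U -> U p -> smooth_field U Y -> smooth_field U Z ->
  (forall x, U x -> Y x = Z x) -> nabla p v Y = nabla p v Z.
Proof.
move=> oU Up sY sZ YZ.
pose W x := Y x + (-1) *: Z x.
pose h x : R := if `[< U x >] then 0 else 1.
have W0 x : U x -> W x = 0 by move=> Ux; rewrite /W YZ// scaleN1r subrr.
have hU x : U x -> h x = 0 by move=> Ux; rewrite /h asboolT.
have sW : smooth_field U W.
  apply: smooth_fieldD => //; apply: (@smooth_field_scale _ _ _ U (fun _ => -1)) => //.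
  exact: smoothM_cst.
have sh : smooth_fun U h.
  apply: (@smoothM_ext _ _ _ _ U (fun _ => 0 : R^o)) => //; last exact: smoothM_cst.
  by move=> x /hU ->.
have hW : W = (fun x => h x *: W x).
  apply/funext => x; rewrite /h; case: asboolP => [/W0 ->|_]; rewrite ?scaler0//.
  by rewrite scale1r.
have nW : nabla p v W = 0.
  rewrite hW (nabla_scale v oU Up sh sW) W0// scaler0 add0r (hU p Up) scale0r //.
have -> : Y = (fun x => W x + Z x).
  by apply/funext => x; rewrite /W scaleN1r subrK.
by rewrite (nablaD v oU Up sW sZ) nW add0r.
Qed.

Lemma nabla0 p v : nabla p v (fun _ => 0) = 0.
Proof.
have s0 := @smooth_field0 _ _ M setT.
have := nablaD v openT (I : setT p) s0 s0.
have -> : (fun q : M => (0 : 'rV[R]_m) + 0) = (fun _ => 0) by apply/funext => x; rewrite addr0.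
by move/eqP; rewrite -subr_eq0 opprD addrA subrr add0r oppr_eq0 => /eqP.
Qed.

Lemma nabla_sum n U p v (Y : 'I_n -> M -> 'rV[R]_m) : open U -> U p ->
  (forall i, smooth_field U (Y i)) ->
  nabla p v (fun x => \sum_i Y i x) = \sum_i nabla p v (Y i).
Proof.
move=> oU Up; elim: n Y => [|n IHn] Y sY.
  rewrite big_ord0 -[RHS](nabla0 p v); congr (nabla p v _).
  by apply/funext => x; rewrite big_ord0.
rewrite big_ord_recl -IHn// -(nablaD v oU Up)//; last exact: smooth_field_sum.
by congr (nabla p v _); apply/funext => x; rewrite big_ord_recl.
Qed.

Lemma nabla_const_linear p v a (u w : 'rV[R]_m) :
  nabla p v (const_field p (a *: u + w)) =
  a *: nabla p v (const_field p u) + nabla p v (const_field p w).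
Proof.
have sc u' := smooth_const_field p u'.
have oc := open_cdom p; have pc := mem_cdom p.
have sa : smooth_fun (cdom p) (fun _ => a : R) by exact: smoothM_cst.
have -> : const_field p (a *: u + w) = (fun x => a *: const_field p u x + const_field p w x).
  by apply/funext => x; rewrite /const_field mulmxDl scalemxAl.
rewrite (nablaD v oc pc (smooth_field_scale oc sa (sc u)) (sc w)).
by rewrite (nabla_scale v oc pc sa (sc u)) dfun_cst scale0r add0r.
Qed.

Lemma nabla_constD p v u w : nabla p v (const_field p (u + w)) =
  nabla p v (const_field p u) + nabla p v (const_field p w).
Proof. by have := nabla_const_linear p v 1 u w; rewrite !scale1r. Qed.

Lemma nabla_const0 p v : nabla p v (const_field p 0) = 0.
Proof.
rewrite -[RHS](nabla0 p v); congr (nabla p v _).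
by apply/funext => x; rewrite /const_field mul0mx.
Qed.

Lemma nabla_constZ p v a u : nabla p v (const_field p (a *: u)) =
  a *: nabla p v (const_field p u).
Proof.
by have := nabla_const_linear p v a u 0; rewrite addr0 nabla_const0 addr0.
Qed.

Hypothesis tn : torsion_free nabla.

(** Symmetry of the Christoffel symbols: the components of a coordinate-constant field are constant
    functions, so the bracket of two such fields annihilates the coordinates. *)
Lemma nabla_const_sym p u v :
  nabla p u (const_field p v) = nabla p v (const_field p u).
Proof.
apply: (@dfun_coordf_ext _ _ _ p) => i.
have oc := open_cdom p; have pc := mem_cdom p.
have sc u' := smooth_const_field p u'.
have si := smooth_coordf p i.
have := tn oc pc (sc u) (sc v) si.
rewrite !const_field_id dfunB; last exact: smooth_dfunable si pc.
have H w z : dfun (fun q => dfun (coordf p i) q (const_field p w q)) p z = 0.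
  rewrite -[RHS](dfun_cst (w 0 i) p z); apply: dfun_near; apply: (open_near oc) => //.
  move=> x px; rewrite dfun_coordf// /const_field -mulmxA trans_comp//; last exact: mem_cdom.
  by rewrite trans_id// mulmx1.
by rewrite !H subr0 => /eqP; rewrite subr_eq0 => /eqP.
Qed.

End Nabla.

(** * Fields along a map *)

Section Pullback.
Context {R : realType} {m n : nat} {M : manifold R m} {N : manifold R n}.
Variable F : M -> N.
Hypothesis sF : smooth_map F.
Implicit Types (p x : M) (V W : M -> 'rV[R]_n) (h : M -> R^o).

Lemma smooth_map_continuous x : {for x, continuous F}.
Proof. by case: sF => + _; apply. Qed.

Lemma near_map x (Q : set N) : nbhs (F x) Q -> \forall y \near x, Q (F y).
Proof. by move=> FQ; have := @smooth_map_continuous x; exact. Qed.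

Lemma map_chart_diff p x q : cdom p x -> cdom q (F x) ->
  differentiable (cmap q \o F \o cinv p) (cmap p x).
Proof.
move=> px qx; case: sF => _ /(_ p q) sFpq.
by apply: smooth_on_diff sFpq _; exists x.
Qed.

Lemma near_map_cdom p : \forall x \near p, cdom (F p) (F x).
Proof.
apply: near_map; apply: open_nbhs_nbhs; split; [exact: open_cdom|exact: mem_cdom].
Qed.

Lemma open_preim (U : set N) : open U -> open (F @^-1` U).
Proof. by move=> oU; apply: open_comp => // x _; exact: smooth_map_continuous. Qed.

Lemma smooth_map_coord q i : smooth_fun (F @^-1` cdom q) (fun x => coordf q i (F x)).
Proof.
move=> p k; case: sF => _ /(_ p q k) sFpq.
apply: (@Ck_on_row _ _ n k _ (cmap q \o F \o cinv p)) => //.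
exact/cmap_image_open/open_preim/open_cdom.
Qed.

Lemma tangent_map_trans p q v : cdom q (F p) ->
  v *m tangent_map F p *m trans (F p) q (F p) =
  'D_v (cmap q \o F \o cinv p) (cmap p p).
Proof.
move=> qp; have pp := mem_cdom p; have Fp := mem_cdom (F p).
have d1 := map_chart_diff pp Fp.
have E : (cmap (F p) \o F \o cinv p) (cmap p p) = cmap (F p) (F p).
  by rewrite /= cmapK.
have d2 : differentiable (cmap q \o cinv (F p)) ((cmap (F p) \o F \o cinv p) (cmap p p)).
  by rewrite E; exact: trans_diff.
rewrite -(deriveEjacobian v d1) /trans -E -(deriveEjacobian _ d2).
rewrite -derive_comp_row//; apply: near_eq_derive.
have : \forall y \near cmap p p, cdom (F p) (F (cinv p y)).
  exact: (near_cinv pp (near_map_cdom p)).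
by apply: filterS => y /= yF; rewrite cmapK.
Qed.

Lemma dfun_map_coord p q v i : cdom q (F p) ->
  dfun (fun x => coordf q i (F x)) p v =
  (v *m tangent_map F p *m trans (F p) q (F p)) 0 i.
Proof.
move=> qp; rewrite tangent_map_trans//.
rewrite /dfun -(@derive_row _ _ _ (cmap q \o F \o cinv p))//.
by apply: map_chart_diff => //; exact: mem_cdom.
Qed.

Lemma dfun_map (h : N -> R^o) p v : dfunable h (F p) ->
  dfun (fun x => h (F x)) p v = dfun h (F p) (v *m tangent_map F p) /\
  dfunable (fun x => h (F x) : R^o) p.
Proof.
move=> dh; have pp := mem_cdom p; have Fp := mem_cdom (F p).
have d1 := map_chart_diff pp Fp.
have E : (cmap (F p) \o F \o cinv p) (cmap p p) = cmap (F p) (F p).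
  by rewrite /= cmapK.
have d2 : differentiable (h \o cinv (F p)) ((cmap (F p) \o F \o cinv p) (cmap p p)).
  by rewrite E.
have near_e : \forall y \near cmap p p,
    ((h \o cinv (F p)) \o (cmap (F p) \o F \o cinv p)) y = ((fun x => h (F x)) \o cinv p) y.
  have : \forall y \near cmap p p, cdom (F p) (F (cinv p y)).
    exact: (near_cinv pp (near_map_cdom p)).
  by apply: filterS => y /= yF; rewrite cmapK.
split.
  rewrite /dfun -(near_eq_derive _ near_e) derive_comp_row// E.
  by rewrite (deriveEjacobian v d1).
by apply: near_eq_differentiable near_e _; exact: differentiable_comp.
Qed.

(** The chart at [F p] is kept fixed while [x] varies, so the components can be differentiated; they
    are meaningful where [F x] lies in that chart, hence near [p]. *)
Definition fcoord p V : M -> 'rV[R]_n := fun x => V x *m trans (F x) (F p) (F x).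

(** A condition at the single point [p]: the covariant derivative along [F] takes one derivative
    there, and projected fields such as [phi] of [push F X] are shown to satisfy it without going
    through smoothness. *)
Definition diff_along p V := differentiable (fcoord p V \o cinv p) (cmap p p).

Lemma diff_along_near p V W : (\near p, V p = W p) -> diff_along p V -> diff_along p W.
Proof.
move=> VW; apply: near_eq_differentiable.
have : \forall x \near p, fcoord p V x = fcoord p W x.
  by apply: filterS VW => x; rewrite /fcoord => ->.
exact: (near_cinv (mem_cdom p)).
Qed.

Lemma diff_alongD p V W : diff_along p V -> diff_along p W ->
  diff_along p (fun x => V x + W x).
Proof.
move=> dV dW; rewrite /diff_along.
have -> : fcoord p (fun x => V x + W x) \o cinv p =
  (fcoord p V \o cinv p) + (fcoord p W \o cinv p).
  by apply/funext => y; rewrite /fcoord /= mulmxDl.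
exact: differentiableD.
Qed.

Lemma fcoord_scale p h V : fcoord p (fun x => h x *: V x) \o cinv p =
  (fun y => (h \o cinv p) y *: (fcoord p V \o cinv p) y).
Proof. by apply/funext => y; rewrite /fcoord /= scalemxAl. Qed.

Lemma diff_along_scale p h V : dfunable h p -> diff_along p V ->
  diff_along p (fun x => h x *: V x).
Proof.
by move=> dh dV; rewrite /diff_along fcoord_scale; exact: differentiable_scale_fun.
Qed.

Lemma fcoord_const p u : \forall x \near p, fcoord p (const_field (F p) u \o F) x = u.
Proof.
apply: filterS (near_map_cdom p) => x Fx.
rewrite /fcoord /= /const_field -mulmxA transK ?mulmx1//; exact: mem_cdom.
Qed.

Lemma diff_along_const p u : diff_along p (const_field (F p) u \o F).
Proof.
rewrite /diff_along.
have H : \forall y \near cmap p p, u = fcoord p (const_field (F p) u \o F) (cinv p y).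
  have H0 : \forall x \near p, u = fcoord p (const_field (F p) u \o F) x.
    by apply: filterS (fcoord_const p u) => x ->.
  exact: (near_cinv (mem_cdom p) H0).
apply: (@near_eq_differentiable _ _ _ (fun _ => u) _ _ H).
exact: differentiable_cst.
Qed.

Lemma dfunable_fcoord p V i : diff_along p V -> dfunable (fun x => fcoord p V x 0 i : R^o) p.
Proof. exact: (@differentiable_row _ _ _ (fcoord p V \o cinv p)). Qed.

Lemma fcoord_decomp p V : \forall x \near p,
  \sum_i fcoord p V x 0 i *: (const_field (F p) (delta_mx 0 i) \o F) x = V x.
Proof.
by apply: filterS (near_map_cdom p) => x Fx;
  rewrite [RHS](@field_const_sum _ _ _ (F p) (F x) (fun _ => V x)).
Qed.

Lemma diff_along_sum p k (V : 'I_k -> M -> 'rV[R]_n) : (forall i, diff_along p (V i)) ->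
  diff_along p (fun x => \sum_i V i x).
Proof.
elim: k V => [|k IHk] V dV.
  have : \forall x \near p, (const_field (F p) (0 : 'rV_n) \o F) x = \sum_(i < 0) V i x.
    by near=> x; rewrite big_ord0 /= /const_field mul0mx.
  by move/diff_along_near; apply; exact: diff_along_const.
have : \forall x \near p, V ord0 x + \sum_(i < k) V (lift ord0 i) x = \sum_i V i x.
  by near=> x; rewrite big_ord_recl.
by move/diff_along_near; apply; apply: diff_alongD => //; exact: IHk.
Unshelve. all: by end_near. Qed.

(* A differentiable field along F is locally a combination of coordinate fields
   of N with differentiable coefficients. *)
Lemma diff_along_ind p (Q : (M -> 'rV[R]_n) -> Prop) :
  (forall V W, (\near p, V p = W p) -> diff_along p V -> Q V -> Q W) ->
  Q (fun _ => 0) ->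
  (forall V W, diff_along p V -> diff_along p W -> Q V -> Q W ->
    Q (fun x => V x + W x)) ->
  (forall h V, dfunable h p -> diff_along p V -> Q V -> Q (fun x => h x *: V x)) ->
  (forall u, Q (const_field (F p) u \o F)) ->
  forall V, diff_along p V -> Q V.
Proof.
move=> Qn Q0 QD QZ Qc V dV.
pose T i x := fcoord p V x 0 i *: (const_field (F p) (delta_mx 0 i) \o F) x.
have dT i : diff_along p (T i).
  by apply: diff_along_scale; [exact: dfunable_fcoord|exact: diff_along_const].
have QT i : Q (T i).
  apply: QZ; [exact: dfunable_fcoord|exact: diff_along_const|exact: Qc].
apply: (Qn _ _ (fcoord_decomp p V)); first exact: diff_along_sum.
suff QS k (S : 'I_k -> M -> 'rV[R]_n) : (forall i, diff_along p (S i)) ->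
    (forall i, Q (S i)) -> Q (fun x => \sum_i S i x) by exact: QS.
elim: k S => [|k IHk] S dS QS.
  suff -> : (fun x : M => \sum_(i < 0) S i x) = (fun _ => 0) by [].
  by apply/funext => x; rewrite big_ord0.
have -> : (fun x : M => \sum_(i < k.+1) S i x) =
    (fun x => S ord0 x + \sum_(i < k) S (lift ord0 i) x).
  by apply/funext => x; rewrite big_ord_recl.
by apply: QD => //; [exact: diff_along_sum|exact: IHk].
Qed.

Section Connection.
Variable nabla : connection_op N.
Hypothesis cn : is_connection nabla.

Local Notation pb := (pullback_connection nabla F).

Lemma pullbackE p v V : pullback_connection nabla F p v V =
  'D_v (fcoord p V \o cinv p) (cmap p p) +
  nabla (F p) (v *m tangent_map F p) (const_field (F p) (V p)).
Proof.
have pp := mem_cdom p.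
rewrite /pullback_connection /cov_along /= cmapK//; congr (_ + nabla _ _ _).
by rewrite -deriveEjacobian//; apply: map_chart_diff => //; exact: mem_cdom.
Qed.

Lemma pullback_near p v V W : (\near p, V p = W p) -> pb p v V = pb p v W.
Proof.
move=> VW; rewrite (pullbackE p v V) (pullbackE p v W) (nbhs_singleton VW).
have H : \forall x \near p, fcoord p V x = fcoord p W x.
  by apply: filterS VW => x; rewrite /fcoord => ->.
by rewrite (near_eq_derive v (near_cinv (mem_cdom p) H)).
Qed.

Lemma pullbackD p v V W : diff_along p V -> diff_along p W ->
  pb p v (fun x => V x + W x) = pb p v V + pb p v W.
Proof.
move=> dV dW; rewrite !pullbackE (nabla_constD cn) addrACA; congr (_ + _).
have -> : fcoord p (fun x => V x + W x) \o cinv p =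
  (fcoord p V \o cinv p) + (fcoord p W \o cinv p).
  by apply/funext => y; rewrite /fcoord /= mulmxDl.
by rewrite deriveD//; exact: diff_derivable.
Qed.

Lemma pullback_scale p v h V : dfunable h p -> diff_along p V ->
  pb p v (fun x => h x *: V x) = dfun h p v *: V p + h p *: pb p v V.
Proof.
move=> dh dV; rewrite !pullbackE fcoord_scale derive_scale_fun//.
have pp := mem_cdom p.
rewrite (nabla_constZ cn) scalerDr addrA /= cmapK//.
congr (_ *: _ + _ + _).
by rewrite /fcoord trans_id ?mulmx1//; exact: mem_cdom.
Qed.

Lemma pullback_const p v u : pb p v (const_field (F p) u \o F) =
  nabla (F p) (v *m tangent_map F p) (const_field (F p) u).
Proof.
rewrite pullbackE /= const_field_id [X in X + _](_ : _ = 0) ?add0r//.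
have H : \forall y \near cmap p p, fcoord p (const_field (F p) u \o F) (cinv p y) = u.
  exact: (near_cinv (mem_cdom p) (fcoord_const p u)).
by rewrite (near_eq_derive _ H); exact: derive_cst.
Qed.

Lemma pullback0 p v : pb p v (fun _ => 0) = 0.
Proof.
have -> : (fun _ : M => 0) = const_field (F p) 0 \o F :> (M -> 'rV[R]_n).
  by apply/funext => x; rewrite /= /const_field mul0mx.
by rewrite pullback_const (nabla_const0 cn).
Qed.

Lemma pullback_sum p v k (V : 'I_k -> M -> 'rV[R]_n) : (forall i, diff_along p (V i)) ->
  pb p v (fun x => \sum_i V i x) = \sum_i pb p v (V i).
Proof.
elim: k V => [|k IHk] V dV.
  rewrite big_ord0 -[RHS](pullback0 p v); congr (pb p v _).
  by apply/funext => x; rewrite big_ord0.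
rewrite big_ord_recl -IHk// -pullbackD//; last exact: diff_along_sum.
by congr (pb p v _); apply/funext => x; rewrite big_ord_recl.
Qed.

Lemma pullback_dir p a u v V : diff_along p V ->
  pb p (a *: u + v) V = a *: pb p u V + pb p v V.
Proof.
move=> dV; rewrite !pullbackE scalerDr addrACA; congr (_ + _).
  by rewrite !deriveE// linearP.
rewrite mulmxDl -scalemxAl.
exact: (nabla_dir cn _ _ _ (@open_cdom _ _ _ (F p)) (mem_cdom (F p)) (smooth_const_field _ _)).
Qed.

(** Expand [Y] in coordinate fields near [F p]. Along [F] the coefficients [c i] become their
    composites with [F], and by the chain rule [dfun_map] both derivatives are the same Leibniz
    sum. *)
Lemma pullback_comp p v (U : set N) (Y : N -> 'rV[R]_n) : open U -> U (F p) ->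
  smooth_field U Y ->
  pb p v (Y \o F) = nabla (F p) (v *m tangent_map F p) Y /\ diff_along p (Y \o F).
Proof.
move=> oU UFp sY; set q := F p; set U' := U `&` cdom q.
have oU' : open U' by apply: openI => //; exact: open_cdom.
have qU' : U' q by split=> //; exact: mem_cdom.
pose c i : N -> R^o := fun y => (Y y *m trans y q y) 0 i.
have sc i : smooth_fun U' (c i).
  apply: smoothM_row => //; by have /smooth_fieldP := sY; apply.
have sd i : smooth_field U' (const_field q (delta_mx 0 i)).
  by apply: smooth_field_sub (smooth_const_field _ _) => y [].
have sYe : smooth_field U' Y by apply: smooth_field_sub sY => y [].
have dc i := smooth_dfunable (sc i) qU'.
have dcF i : dfunable (fun x => c i (F x) : R^o) p by have [_] := dfun_map 0 (dc i).
have dT i : diff_along p (fun x => c i (F x) *: (const_field q (delta_mx 0 i) \o F) x).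
  by apply: diff_along_scale => //; exact: diff_along_const.
have nearY : \forall x \near p,
    \sum_i c i (F x) *: (const_field q (delta_mx 0 i) \o F) x = (Y \o F) x.
  apply: filterS (near_map_cdom p) => x Fx.
  by rewrite [RHS](@field_const_sum _ _ _ q (F x)).
split; last by apply: diff_along_near nearY _; exact: diff_along_sum.
rewrite -(pullback_near _ nearY) pullback_sum//.
set w := v *m tangent_map F p.
rewrite (@nabla_near _ _ _ _ cn U' q w Y
  (fun y => \sum_i c i y *: const_field q (delta_mx 0 i) y)) //.
- rewrite (nabla_sum cn w oU')//; last by move=> i; exact: smooth_field_scale.
  apply: eq_bigr => i _.
  rewrite pullback_scale//; last exact: diff_along_const.
  rewrite (pullback_const p v) (nabla_scale cn w oU' qU' (sc i) (sd i)).
  by have [-> _] := dfun_map v (dc i).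
- by apply: smooth_field_sum => // i; exact: smooth_field_scale.
- by move=> y [Uy qy]; exact: field_const_sum.
Qed.

End Connection.

Lemma fcoord_push p (X : M -> 'rV[R]_m) i : \forall x \near p,
  fcoord p (push F X) x 0 i = dfun (fun x => coordf (F p) i (F x)) x (X x).
Proof.
by apply: filterS (near_map_cdom p) => x Fx; rewrite dfun_map_coord.
Qed.

(** The components of the pushed field are the derivatives along [X] of the coordinates of [F],
    which are smooth functions. *)
Lemma diff_along_push p U (X : M -> 'rV[R]_m) : open U -> U p -> smooth_field U X ->
  diff_along p (push F X).
Proof.
move=> oU Up sX; set U' := U `&` F @^-1` cdom (F p).
have oU' : open U' by apply: openI => //; exact/open_preim/open_cdom.
have U'p : U' p by split=> //; exact: mem_cdom.
have sXd i : smooth_fun U' (fun x => dfun (fun x => coordf (F p) i (F x)) x (X x)).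
  apply: smooth_field_dfun => //.
    by apply: smoothM_sub (smooth_map_coord (F p) i) => x [].
  by apply: smooth_field_sub sX => x [].
pose V x := \sum_i dfun (fun x => coordf (F p) i (F x)) x (X x) *:
  (const_field (F p) (delta_mx 0 i) \o F) x.
have : \forall x \near p, V x = push F X x.
  apply: filterS (near_map_cdom p) => x Fx.
  rewrite [RHS](@field_const_sum _ _ _ (F p) (F x) (fun _ => push F X x))//.
  by apply: eq_bigr => i _; rewrite dfun_map_coord.
move/diff_along_near; apply; apply: diff_along_sum => i.
apply: diff_along_scale; first exact: smooth_dfunable (sXd i) U'p.
exact: diff_along_const.
Qed.

End Pullback.

(** * Orthonormal frames *)

Section InnerProductTheory.
Context {R : realType} {n : nat} (G : 'M[R]_n).
Implicit Types u v w : 'rV[R]_n.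

Lemma ipDl u v w : ip G (u + v) w = ip G u w + ip G v w.
Proof. by rewrite /ip !mulmxDl mxE. Qed.

Lemma ipZl a u v : ip G (a *: u) v = a * ip G u v.
Proof. by rewrite /ip -!scalemxAl mxE. Qed.

Lemma ipDr u v w : ip G u (v + w) = ip G u v + ip G u w.
Proof. by rewrite /ip linearD mulmxDr mxE. Qed.

Lemma ipZr a u v : ip G u (a *: v) = a * ip G u v.
Proof. by rewrite /ip linearZ -scalemxAr mxE. Qed.

Lemma ip0l u : ip G 0 u = 0.
Proof. by rewrite /ip !mul0mx mxE. Qed.

Lemma ip0r u : ip G u 0 = 0.
Proof. by rewrite /ip trmx0 mulmx0 mxE. Qed.

Lemma ipNl u v : ip G (- u) v = - ip G u v.
Proof. by rewrite -scaleN1r ipZl mulN1r. Qed.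

Lemma ipBl u v w : ip G (u - v) w = ip G u w - ip G v w.
Proof. by rewrite ipDl ipNl. Qed.

Lemma ip_suml k (f : 'I_k -> 'rV[R]_n) u :
  ip G (\sum_i f i) u = \sum_i ip G (f i) u.
Proof. exact: (big_morph (ip G ^~ u) (fun v w => ipDl v w u) (ip0l u)). Qed.

Lemma ip_sumr k (f : 'I_k -> 'rV[R]_n) u :
  ip G u (\sum_i f i) = \sum_i ip G u (f i).
Proof. exact: (big_morph (ip G u) (ipDr u) (ip0r u)). Qed.

Lemma sub_orthcompP k (A : 'M[R]_(k, n)) u :
  (u <= orthcomp G A)%MS <-> (forall v, (v <= A)%MS -> ip G u v = 0).
Proof.
split=> [/sub_kermxP uA v /submxP[w ->]|uA].
  by rewrite /ip trmx_mul !mulmxA -(mulmxA u) uA mul0mx mxE.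
apply/sub_kermxP/rowP => j; have := uA _ (row_sub j A).
by rewrite /ip rowE trmx_mul trmx_delta mulmxA -(mulmxA u) -colE mxE => ->; rewrite mxE.
Qed.

Hypothesis Gsym : G^T = G.
Hypothesis Gpos : forall v, v != 0 -> 0 < ip G v v.

Lemma ipC u v : ip G u v = ip G v u.
Proof.
have -> : ip G u v = ((u *m G *m v^T)^T) 0 0 by rewrite mxE.
by rewrite !trmx_mul trmxK Gsym mulmxA.
Qed.

Lemma ip_eq0 v : ip G v v = 0 -> v = 0.
Proof.
by move=> vv; apply/eqP; apply: contraT => /Gpos; rewrite vv ltxx.
Qed.

Lemma gram_unit : G \in unitmx.
Proof.
rewrite -row_free_unit -kermx_eq0; apply/eqP/row_matrixP => i.
have := row_sub i (kermx G); move/sub_kermxP => uG.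
by rewrite row0; apply: ip_eq0; rewrite /ip uG mul0mx mxE.
Qed.

Lemma orthcomp_cap k (A : 'M[R]_(k, n)) : (A :&: orthcomp G A)%MS = 0.
Proof.
apply/eqP; rewrite -submx0; apply/row_subP => i.
have := row_sub i (A :&: orthcomp G A)%MS.
by rewrite sub_capmx => /andP[uA /sub_orthcompP/(_ _ uA)/ip_eq0 ->]; exact: sub0mx.
Qed.

Lemma rank_orthcomp k (A : 'M[R]_(k, n)) : \rank (orthcomp G A) = (n - \rank A)%N.
Proof.
rewrite /orthcomp mxrank_ker; congr (_ - _)%N.
rewrite (eqmxMfull _ _); first by rewrite mxrank_tr.
by rewrite row_full_unit gram_unit.
Qed.

Lemma orthcomp_full k (A : 'M[R]_(k, n)) u : (u <= A + orthcomp G A)%MS.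
Proof.
apply: submx_full; rewrite /row_full; apply/eqP.
rewrite mxrank_disjoint_sum ?orthcomp_cap// rank_orthcomp subnKC//.
exact: rank_leq_col.
Qed.

Lemma orthcompS k1 k2 (A : 'M[R]_(k1, n)) (B : 'M[R]_(k2, n)) :
  (A <= B)%MS -> (orthcomp G B <= orthcomp G A)%MS.
Proof.
move=> AB; apply/row_subP => i; apply/sub_orthcompP => v vA.
by have /sub_orthcompP := row_sub i (orthcomp G B); apply; exact: submx_trans AB.
Qed.

Lemma orthcompK k (A : 'M[R]_(k, n)) : (orthcomp G (orthcomp G A) == A)%MS.
Proof.
have AA : (A <= orthcomp G (orthcomp G A))%MS.
  apply/row_subP => i; apply/sub_orthcompP => v /sub_orthcompP vA.
  by rewrite ipC; apply: vA; exact: row_sub.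
have := mxrank_leqif_sup AA; rewrite !rank_orthcomp => -[_].
by rewrite subKn ?rank_leq_col// eqxx => <-; rewrite AA.
Qed.

Lemma orthonormal_free k (E : 'I_k -> 'rV[R]_n) :
  (forall i j, ip G (E i) (E j) = (i == j)%:R) -> row_free (\matrix_i E i).
Proof.
(* Orthonormality says that the product of the matrix of rows [E i], of [G] and of its transpose is
   1, which exhibits a right inverse. *)
move=> Eo; apply/row_freeP; exists (G *m (\matrix_i E i)^T).
apply/matrixP => i j; set Em := \matrix_i E i.
have -> : (Em *m (G *m Em^T)) i j = ip G (row i Em) (row j Em).
  by rewrite /ip !rowE trmx_mul trmx_delta !mulmxA -colE [RHS]mxE -!mulmxA -rowE [RHS]mxE.
by rewrite !rowK Eo mxE.
Qed.

Lemma orthonormal_expand k (A : 'M[R]_n) (E : 'I_k -> 'rV[R]_n) u :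
  \rank A = k -> (forall i, (E i <= A)%MS) ->
  (forall i j, ip G (E i) (E j) = (i == j)%:R) -> (u <= A)%MS ->
  u = \sum_i ip G u (E i) *: E i.
Proof.
move=> rA EA Eo uA; have Ef := orthonormal_free Eo.
have EmA : (\matrix_i E i <= A)%MS by apply/row_subP => i; rewrite rowK.
have AEm : (A <= \matrix_i E i)%MS.
  have [_] := mxrank_leqif_sup EmA; rewrite rA.
  by move: Ef; rewrite /row_free => /eqP ->; rewrite eqxx => <-.
have /submxP[c uc] := submx_trans uA AEm.
have ucE : u = \sum_i c 0 i *: E i.
  by rewrite uc mulmx_sum_row; apply: eq_bigr => i _; rewrite rowK.
rewrite {1}ucE; apply: eq_bigr => j _; congr (_ *: _).
rewrite ucE ip_suml (bigD1 j)//= ipZl Eo eqxx mulr1 big1 ?addr0// => i ij.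
by rewrite ipZl Eo (negPf ij) mulr0.
Qed.

Lemma gs_residual k (E : 'I_k -> 'rV[R]_n) u j :
  (forall i j, ip G (E i) (E j) = (i == j)%:R) ->
  ip G (u - \sum_i ip G u (E i) *: E i) (E j) = 0.
Proof.
move=> Eo; rewrite ipBl ip_suml (bigD1 j)//= ipZl Eo eqxx mulr1.
rewrite big1 ?addr0 ?subrr// => i ij.
by rewrite ipZl Eo (negPf ij) mulr0.
Qed.

Lemma proj_mx_add (A B : 'M[R]_n) u v : (A :&: B)%MS = 0 -> (u <= A)%MS -> (v <= B)%MS ->
  (u + v) *m proj_mx A B = u.
Proof. by move=> AB uA vB; rewrite mulmxDl proj_mx_id// proj_mx_0// addr0. Qed.

Lemma sub_sum_split (A B : 'M[R]_n) u : (u <= A + B)%MS ->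
  exists v w, [/\ (v <= A)%MS, (w <= B)%MS & u = v + w].
Proof.
move=> /sub_addsmxP[[a b] /= ->]; exists (a *m A), (b *m B).
by split=> //; exact: submxMl.
Qed.

End InnerProductTheory.

Section Frames.
Context {R : realType} {m : nat} {M : manifold R m}.
Variable g : M -> 'M[R]_m.
Hypothesis mg : is_metric g.
Implicit Types (U : set M) (p q x : M).

Lemma riem_metric_sym p : (g p)^T = g p.
Proof. by case: mg. Qed.

Lemma riem_metric_pos p v : v != 0 -> 0 < ip (g p) v v.
Proof. by case: mg => _ + _; apply. Qed.

Lemma smooth_ip U X Y : open U -> smooth_field U X -> smooth_field U Y ->
  smooth_fun U (fun p => ip (g p) (X p) (Y p)).
Proof. by case: mg => _ _; apply. Qed.

Definition orthonormal_family (A : M -> 'M[R]_m) U k (E : 'I_k -> M -> 'rV[R]_m) :=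
  [/\ open U, forall i, smooth_field U (E i) &
     forall q, U q -> (forall i, (E i q <= A q)%MS) /\
       (forall i j, ip (g q) (E i q) (E j q) = (i == j)%:R)].

(** The residual [Z] of [Y] is nonzero at [p] because [Y p] lies outside the span; by continuity its
    square norm stays positive on a smaller [V], where it can be normalised smoothly. *)
Lemma gram_schmidt_step A U k (E : 'I_k -> M -> 'rV[R]_m) Y p :
  orthonormal_family A U E -> U p -> smooth_field U Y ->
  (forall q, U q -> (Y q <= A q)%MS) -> ~~ (Y p <= \matrix_i E i p)%MS ->
  exists V (E' : 'I_k.+1 -> M -> 'rV[R]_m),
    [/\ V `<=` U, V p & orthonormal_family A V E'].
Proof.
move=> [oU sE AE] Up sY AY nY.
pose Z q := Y q - \sum_i ip (g q) (Y q) (E i q) *: E i q.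
have sZ : smooth_field U Z.
  apply: (@smooth_field_ext _ _ _ U
    (fun q => Y q + (-1) *: (\sum_i ip (g q) (Y q) (E i q) *: E i q))) => //.
    by move=> q _; rewrite scaleN1r.
  apply: smooth_fieldD => //.
  apply: (@smooth_field_scale _ _ _ U (fun _ => -1)) => //; first exact: smoothM_cst.
  apply: smooth_field_sum => // i; apply: smooth_field_scale => //.
  exact: smooth_ip.
have Zp0 : Z p != 0.
  apply: contraNneq nY => /eqP; rewrite subr_eq0 => /eqP ->.
  apply: summx_sub => i _; apply: scalemx_sub.
  by rewrite -[X in (X <= _)%MS](rowK (fun i => E i p) i); exact: row_sub.
have [V [oV Vp VU Vpos]] := smoothM_gt0 oU (smooth_ip oU sZ sZ) Up (riem_metric_pos p Zp0).
pose e q := (Num.sqrt (ip (g q) (Z q) (Z q)))^-1 *: Z q.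
have se : smooth_field V e.
  apply: smooth_field_scale => //; last exact: smooth_field_sub sZ.
  apply: smoothM_invsqrt => //.
  by apply: smooth_ip => //; exact: smooth_field_sub sZ.
have ZE q j : U q -> ip (g q) (Z q) (E j q) = 0.
  by move=> Uq; have [_ Eo] := AE _ Uq; exact: gs_residual.
have ee q : V q -> ip (g q) (e q) (e q) = 1.
  move=> Vq; rewrite /e ipZl ipZr mulrA -invfM -expr2 sqr_sqrtr; last exact/ltW/Vpos.
  by rewrite mulVf// gt_eqF// Vpos.
have eE q j : V q -> ip (g q) (e q) (E j q) = 0.
  by move=> Vq; rewrite /e ipZl ZE ?mulr0//; exact: VU.
have Ae q : V q -> (e q <= A q)%MS.
  move=> /VU Uq; have [AEq _] := AE _ Uq; apply: scalemx_sub.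
  apply: addmx_sub; first exact: AY.
  rewrite -scaleN1r; apply: scalemx_sub; apply: summx_sub => i _.
  exact: scalemx_sub.
(* The new field takes index [ord0], and [lift ord0] carries the old indices. *)
exists V, (fun i => if unlift ord0 i is Some j then E j else e); split=> //.
split=> // [i|q Vq].
  by case: unliftP => [j _|_] //; exact: smooth_field_sub (sE j).
have [AEq Eo] := AE _ (VU _ Vq); split=> [i|i j].
  by case: unliftP => [j _|_] //; exact: Ae.
case: unliftP => [i' ->|->]; case: unliftP => [j' ->|->].
- by rewrite Eo (inj_eq lift_inj).
- rewrite (ipC (riem_metric_sym q)) eE// eq_sym;
    by case: eqP => // /eqP; rewrite (negPf (neq_lift _ _)).
- by rewrite eE//; case: eqP => // /eqP; rewrite (negPf (neq_lift _ _)).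
- by rewrite ee// eqxx.
Qed.

(** The sections [Y] need to span [A] at [p] only. While fewer than [k] fields have been chosen, a
    rank count at [p] supplies a [Y a] outside their span; once there are [k], the constant rank of
    [A] makes them a frame on a neighbourhood. *)
Lemma orthonormal_frame_exists A U k l (Y : 'I_l -> M -> 'rV[R]_m) p :
  open U -> U p -> (forall a, smooth_field U (Y a)) ->
  (forall a q, U q -> (Y a q <= A q)%MS) -> (forall q, U q -> \rank (A q) = k) ->
  (A p <= \matrix_a Y a p)%MS ->
  exists V (E : 'I_k -> M -> 'rV[R]_m),
    [/\ V `<=` U, V p & local_onframe g A V E].
Proof.
move=> oU Up sY AY rA spanA.
have H j : (j <= k)%N -> exists V (E : 'I_j -> M -> 'rV[R]_m),
    [/\ V `<=` U, V p & orthonormal_family A V E].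
  elim: j => [_|j IHj jk].
    by exists U, (fun _ _ => 0); split=> //; split=> // [|q _]; [case|split; case].
  have [V [E [VU Vp oE]]] := IHj (ltnW jk).
  have [a Ya] : exists a, ~~ (Y a p <= \matrix_i E i p)%MS.
    have : ~~ (\matrix_a Y a p <= \matrix_i E i p)%MS.
      apply/negP => YE; have := mxrankS (submx_trans spanA YE).
      rewrite rA// leqNgt => /negP; apply.
      exact: leq_ltn_trans (rank_leq_row _) jk.
    by move=> /row_subPn[a]; rewrite rowK => Ya; exists a.
  have AYV q : V q -> (Y a q <= A q)%MS by move=> /VU; exact: AY.
  have [V' [E' [V'V V'p oE']]] :=
    gram_schmidt_step oE Vp (smooth_field_sub VU (sY a)) AYV Ya.
  by exists V', E'; split=> //; exact: subset_trans V'V VU.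
have [V [E [VU Vp [oV sE AE]]]] := H k (leqnn k).
exists V, E; split=> //; split=> // q Vq.
by have [? ?] := AE _ Vq; split=> //; exact/rA/VU.
Qed.

End Frames.

(** * Frames adapted to the kernel of a map of constant rank *)

Section AdaptedFrames.
Context {R : realType} {m n : nat} {M : manifold R m} {N : manifold R n}.
Variables (g : M -> 'M[R]_m) (F : M -> N) (r : nat).
Hypothesis mg : is_metric g.
Hypothesis sF : smooth_map F.
Hypothesis rF : forall p, \rank (tangent_map F p) = r.
Implicit Types (U : set M) (p q x : M).

Lemma rank_ker_bundle p : \rank (ker_bundle F p) = (m - r)%N.
Proof. by rewrite mxrank_ker rF. Qed.

Lemma rank_le_dim p : (r <= m)%N.
Proof. by rewrite -(rF p); exact: rank_leq_row. Qed.

Lemma rank_ker_perp p : \rank (ker_perp g F p) = r.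
Proof.
rewrite rank_orthcomp; [|exact: riem_metric_pos mg p].
by rewrite rank_ker_bundle subKn// (rank_le_dim p).
Qed.

Lemma full_frame_exists p : exists U (E : 'I_m -> M -> 'rV[R]_m),
  U p /\ local_onframe g (fun _ => 1%:M) U E.
Proof.
have span : (1%:M <= \matrix_a const_field p (delta_mx 0 a : 'rV[R]_m) p)%MS.
  apply/row_subP => i; rewrite row1.
  have <- : row i (\matrix_a const_field p (delta_mx 0 a) p) = delta_mx 0 i.
    by rewrite rowK const_field_id.
  exact: row_sub.
have [V [E [_ Vp oE]]] := @orthonormal_frame_exists _ _ _ g mg (fun _ => 1%:M)
    (cdom p) m m _ p (@open_cdom _ _ _ p) (mem_cdom p)
    (fun a => smooth_const_field p _) (fun _ _ _ => submx1 _)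
    (fun _ _ => mxrank1 _ _) span.
by exists V, E.
Qed.

(* (ker F_* )^\perp is spanned by the gradients of the coordinates of F. *)
Lemma ker_perp_frame_exists p : exists U (X : 'I_r -> M -> 'rV[R]_m),
  U p /\ local_onframe g (ker_perp g F) U X.
Proof.
have [U [E [Up [oU sE oE]]]] := full_frame_exists p.
pose U' := U `&` F @^-1` cdom (F p).
have oU' : open U' by apply: openI => //; apply: open_preim => //; exact: open_cdom.
have U'p : U' p by split=> //; exact: mem_cdom.
pose c b : M -> R^o := fun x => coordf (F p) b (F x).
pose Y b q := \sum_i dfun (c b) q (E i q) *: E i q.
have sE' i : smooth_field U' (E i) by apply: smooth_field_sub (sE i) => q [].
have sc b : smooth_fun U' (c b).
  by apply: smoothM_sub (smooth_map_coord sF (F p) b) => q [].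
have sY b : smooth_field U' (Y b).
  apply: smooth_field_sum => // i; apply: smooth_field_scale => //.
  exact: smooth_field_dfun.
have Yu b q u : U' q -> ip (g q) (Y b q) u = dfun (c b) q u.
  move=> U'q; have [Uq Fq] := U'q; have [_ _ Eo] := oE _ Uq.
  have Eu := orthonormal_expand (mxrank1 _ _) (fun i => submx1 _) Eo (submx1 u).
  have dc := smooth_dfunable (sc b) U'q.
  rewrite [in RHS]Eu /dfun deriveE// linear_sum ip_suml.
  apply: eq_bigr => i _; rewrite linearZ ipZl mulrC -deriveE//.
  by rewrite (ipC (riem_metric_sym mg q)).
have dcE b q u : U' q -> dfun (c b) q u = (u *m tangent_map F q *m trans (F q) (F p) (F q)) 0 b.
  by move=> [_ Fq]; rewrite /c dfun_map_coord.
have AY b q : U' q -> (Y b q <= ker_perp g F q)%MS.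
  move=> U'q; apply/sub_orthcompP => v /sub_kermxP vT.
  by rewrite Yu// dcE// vT mul0mx mxE.
have gpos := riem_metric_pos mg p.
have span : (ker_perp g F p <= \matrix_b Y b p)%MS.
  have /andP[KK _] := orthcompK (riem_metric_sym mg p) gpos (\matrix_b Y b p).
  (* Passing to orthogonal complements, it suffices that a vector orthogonal to every [Y b p] lies
     in the kernel: it annihilates each coordinate of [F]. *)
  apply: submx_trans _ KK; apply: orthcompS => //.
  apply/row_subP => i; set u := row i _.
  have /sub_orthcompP uY : (u <= orthcomp (g p) (\matrix_b Y b p))%MS by exact: row_sub.
  apply/sub_kermxP/rowP => b; rewrite [RHS]mxE.
  have := dcE b p u U'p; rewrite trans_id ?mulmx1; last exact: mem_cdom.
  move=> <-; rewrite -Yu// (ipC (riem_metric_sym mg p)); apply: uY.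
  have <- : row b (\matrix_b Y b p) = Y b p by rewrite rowK.
  exact: row_sub.
have [V [X [_ Vp oX]]] := orthonormal_frame_exists mg oU' U'p sY AY
  (fun q _ => rank_ker_perp q) span.
by exists V, X.
Qed.

(** Sections of the kernel are produced from a frame [X] of its complement: coordinate fields minus
    their projections onto [X] are orthogonal to [ker_perp], hence lie in [ker_bundle]. *)
Lemma adapted_frame_exists p :
  exists U (X : 'I_r -> M -> 'rV[R]_m) (K : 'I_(m - r) -> M -> 'rV[R]_m),
  [/\ U p, local_onframe g (ker_perp g F) U X & local_onframe g (ker_bundle F) U K].
Proof.
have [U [X [Up [oU sX oX]]]] := ker_perp_frame_exists p.
pose U' := U `&` cdom p.
have oU' : open U' by apply: openI => //; exact: open_cdom.
have U'p : U' p by split=> //; exact: mem_cdom.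
have sX' i : smooth_field U' (X i) by apply: smooth_field_sub (sX i) => q [].
pose d a := const_field p (delta_mx 0 a : 'rV[R]_m).
have sd a : smooth_field U' (d a).
  by apply: smooth_field_sub (smooth_const_field p _) => q [].
pose Y a q := d a q - \sum_i ip (g q) (d a q) (X i q) *: X i q.
have sY a : smooth_field U' (Y a).
  apply: (@smooth_field_ext _ _ _ U'
    (fun q => d a q + (-1) *: (\sum_i ip (g q) (d a q) (X i q) *: X i q))) => //.
    by move=> q _; rewrite scaleN1r.
  apply: smooth_fieldD => //.
  apply: (@smooth_field_scale _ _ _ U' (fun _ => -1)) => //; first exact: smoothM_cst.
  apply: smooth_field_sum => // i; apply: smooth_field_scale => //.
  exact: smooth_ip.
have AY a q : U' q -> (Y a q <= ker_bundle F q)%MS.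
  move=> [Uq _]; have [rX XA Xo] := oX _ Uq.
  have /andP[KK _] := orthcompK (riem_metric_sym mg q) (riem_metric_pos mg q) (ker_bundle F q).
  apply: submx_trans _ KK; apply/sub_orthcompP => v vK.
  rewrite [v](orthonormal_expand rX XA Xo vK) ip_sumr big1// => i _.
  by rewrite ipZr gs_residual// mulr0.
have span : (ker_bundle F p <= \matrix_a Y a p)%MS.
  have [_ XA _] := oX _ Up.
  apply/row_subP => i; set u := row i _.
  have uK : (u <= ker_bundle F p)%MS by exact: row_sub.
  (* A kernel vector has the same coefficients in the [Y a] as in the coordinate basis, because the
     projections subtracted add up to its own products with the [X j], which vanish. *)
  suff -> : u = u *m \matrix_a Y a p by exact: submxMl.
  have uX j : ip (g p) u (X j p) = 0.
    rewrite (ipC (riem_metric_sym mg p)).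
    by have /sub_orthcompP := XA j; apply.
  rewrite mulmx_sum_row.
  under eq_bigr => a _ do rewrite rowK /Y scalerBr /d const_field_id.
  rewrite sumrB -row_sum_delta [X in _ - X](_ : _ = 0) ?subr0//.
  under eq_bigr => a _ do rewrite scaler_sumr.
  rewrite exchange_big big1// => j _.
  under eq_bigr => a _ do rewrite scalerA -ipZl.
  by rewrite -scaler_suml -ip_suml -row_sum_delta uX scale0r.
have [V [K [VU' Vp oK]]] := orthonormal_frame_exists mg oU' U'p sY AY
  (fun q _ => rank_ker_bundle q) span.
exists V, X, K; split=> //; have VU : V `<=` U by move=> q /VU'[].
have [oV _ _] := oK; split=> // [i|q /VU /oX//].
exact: smooth_field_sub (sX i).
Qed.

End AdaptedFrames.

(** * The second fundamental form *)

Section SecondFundamentalForm.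
Context {R : realType} {m n : nat} {M : manifold R m} {N : manifold R n}.
Variables (gM : M -> 'M[R]_m) (gN : N -> 'M[R]_n).
Variables (nablaM : connection_op M) (nablaN : connection_op N).
Variable F : M -> N.
Hypothesis mgM : is_metric gM.
Hypothesis mgN : is_metric gN.
Hypothesis lcM : is_levi_civita gM nablaM.
Hypothesis lcN : is_levi_civita gN nablaN.
Hypothesis sF : smooth_map F.
Implicit Types (U : set M) (p q x : M) (V W : M -> 'rV[R]_n) (h : M -> R^o).
Implicit Types (X Y Z : M -> 'rV[R]_m).

Let cnM : is_connection nablaM. Proof. by case: lcM. Qed.
Let cnN : is_connection nablaN. Proof. by case: lcN. Qed.

Local Notation pb := (pullback_connection nablaN F).
Local Notation ipF V W := (fun x => ip (gN (F x)) (V x) (W x) : R^o).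

(** Differentiability of the inner product travels with the formula, since the sum and product rules
    used in the induction on fields require it. *)
Let metric_leibniz p v V W := dfunable (ipF V W) p /\
  dfun (ipF V W) p v =
  ip (gN (F p)) (pb p v V) (W p) + ip (gN (F p)) (V p) (pb p v W).

Let metric_leibnizC p v V W : metric_leibniz p v V W -> metric_leibniz p v W V.
Proof.
have E : ipF V W = ipF W V by apply/funext => x; rewrite (ipC (riem_metric_sym mgN _)).
rewrite /metric_leibniz E => -[dVW ->]; split=> //.
by rewrite addrC (ipC (riem_metric_sym mgN _) (V p)) (ipC (riem_metric_sym mgN _) _ (W p)).
Qed.

Let metric_leibniz_ind p v W :
  (forall u, metric_leibniz p v (const_field (F p) u \o F) W) ->
  forall V, diff_along F p V -> metric_leibniz p v V W.
Proof.
move=> Qc; apply: (diff_along_ind sF) => //.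
- move=> V V' VV' dV [dVW E]; have VV'p : V p = V' p := nbhs_singleton VV'.
  have ipVV' : \forall x \near p, ipF V W x = ipF V' W x.
    by apply: filterS VV' => x ->.
  split; first exact: dfunable_near ipVV' dVW.
  by rewrite -(dfun_near _ ipVV') E VV'p (pullback_near sF nablaN v VV').
- have E : ipF (fun _ => 0) W = (fun _ => 0) by apply/funext => x; rewrite ip0l.
  split; rewrite E; first exact: differentiable_cst.
  by rewrite dfun_cst (pullback0 sF cnN) !ip0l addr0.
- move=> V V' dV dV' [dVW E] [dVW' E'].
  have S : ipF (fun x => V x + V' x) W = (fun x => ipF V W x + ipF V' W x).
    by apply/funext => x; rewrite ipDl.
  split; rewrite S; first exact: dfunableD.
  by rewrite dfunD// E E' (pullbackD sF cnN)// !ipDl addrACA.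
- move=> h V dh dV [dVW E].
  have S : ipF (fun x => h x *: V x) W = (fun x => h x * ipF V W x).
    by apply/funext => x; rewrite ipZl.
  split; rewrite S; first exact: dfunableM.
  rewrite dfunM// E (pullback_scale sF cnN)//.
  by move: (pb p v V) (pb p v W) => B C; rewrite ipDl !ipZl; ring.
Qed.

(** Reducing each argument in turn to coordinate fields of [N] leaves metric compatibility of
    [nablaN], composed with [F]. *)
Lemma pullback_metric p v V W : diff_along F p V -> diff_along F p W ->
  metric_leibniz p v V W.
Proof.
move=> dV dW; apply: metric_leibniz_ind dV => u.
apply: metric_leibnizC; apply: metric_leibniz_ind dW => w.
have oc := open_cdom (F p); have Fc := mem_cdom (F p).
have su u' := smooth_const_field (F p) u'.
have sg := smooth_ip mgN oc (su w) (su u).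
have [E d] := dfun_map sF v (smooth_dfunable sg Fc).
split; first exact: d.
rewrite (pullback_const sF nablaN p v w) (pullback_const sF nablaN p v u).
apply: etrans E _; have [_ _ mc] := lcN.
exact: mc oc Fc (su w) (su u).
Qed.

(** [second_fundamental_form X Y p] is [sff_dir p (X p) Y]. Taking the direction as a single vector
    lets a change of frame be expanded in the two slots separately. *)
Definition sff_dir p u Y : 'rV[R]_n := pb p u (push F Y) - nablaM p u Y *m tangent_map F p.

(** In coordinates the Christoffel terms of [N] cancel by [nabla_const_sym]. What remains is the
    bracket of [X] and [Y] acting on the coordinates of [F], and torsion-freeness of [nablaM]
    matches it with the terms from [M]. *)
Lemma sff_sym U X Y p : open U -> U p -> smooth_field U X -> smooth_field U Y ->
  sff_dir p (X p) Y = sff_dir p (Y p) X.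
Proof.
move=> oU Up sX sY; have pp := mem_cdom p; have Fp := mem_cdom (F p).
set U' := U `&` F @^-1` cdom (F p).
have oU' : open U' by apply: openI => //; exact/(open_preim sF)/open_cdom.
have U'p : U' p by split.
have sX' : smooth_field U' X by apply: smooth_field_sub sX => x [].
have sY' : smooth_field U' Y by apply: smooth_field_sub sY => x [].
pose c i : M -> R^o := fun x => coordf (F p) i (F x).
have sc i : smooth_fun U' (c i).
  by apply: smoothM_sub (smooth_map_coord sF (F p) i) => q [].
have DE Z u i : smooth_field U' Z ->
   ('D_u (fcoord F p (push F Z) \o cinv p) (cmap p p)) 0 i =
   dfun (fun x => dfun (c i) x (Z x)) p u.
  move=> sZ; have dZ := diff_along_push sF oU' U'p sZ.
  rewrite -(derive_row _ _ dZ).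
  apply: (@dfun_near _ _ _ (fun x => fcoord F p (push F Z) x 0 i)).
  exact: fcoord_push.
have [_ tM _] := lcM; have [_ tN _] := lcN.
have nsym : nablaN (F p) (X p *m tangent_map F p) (const_field (F p) (push F Y p))
    = nablaN (F p) (Y p *m tangent_map F p) (const_field (F p) (push F X p)).
  exact: nabla_const_sym tN _ _ _.
rewrite /sff_dir (pullbackE sF nablaN p (X p) (push F Y)).
rewrite (pullbackE sF nablaN p (Y p) (push F X)) nsym.
apply/rowP => i.
have : dfun (c i) p (nablaM p (X p) Y - nablaM p (Y p) X) =
    ('D_(X p) (fcoord F p (push F Y) \o cinv p) (cmap p p)) 0 i -
    ('D_(Y p) (fcoord F p (push F X) \o cinv p) (cmap p p)) 0 i.
  rewrite (DE _ _ _ sX') (DE _ _ _ sY').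
  exact: tM oU' U'p sX' sY' (sc i).
rewrite dfun_map_coord// trans_id// mulmx1 mulmxBl.
move: (nablaN _ _ _) (nablaM p (X p) Y *m _) (nablaM p (Y p) X *m _).
move: ('D_(X p) _ _) ('D_(Y p) _ _) => a b c1 d e; rewrite !mxE => E.
have -> : a 0 i = b 0 i + (d 0 i - e 0 i) by rewrite E addrC subrK.
by ring.
Qed.

Lemma sff_dirP U Y p a u v : open U -> U p -> smooth_field U Y ->
  sff_dir p (a *: u + v) Y = a *: sff_dir p u Y + sff_dir p v Y.
Proof.
move=> oU Up sY; rewrite /sff_dir (pullback_dir sF cnN)//; last first.
  exact: diff_along_push oU Up sY.
rewrite (nabla_dir cnM _ _ _ oU Up sY) mulmxDl -scalemxAl scalerBr opprD.
by move: (pb p u _) (pb p v _) => b c; rewrite addrACA.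
Qed.

Lemma sff_dir_near U Y Z p u : open U -> U p -> smooth_field U Y -> smooth_field U Z ->
  (forall x, U x -> Y x = Z x) -> sff_dir p u Y = sff_dir p u Z.
Proof.
move=> oU Up sY sZ YZ; rewrite /sff_dir (nabla_near cnM u oU Up sY sZ YZ).
rewrite (@pullback_near _ _ _ _ _ F sF nablaN p u (push F Y) (push F Z))//.
by apply: (open_near oU Up) => x Ux; rewrite /push YZ.
Qed.

(** Tensoriality in the second slot: the two Leibniz rules produce the same terms in the derivatives
    of the [h i], and these cancel in the difference. *)
Lemma sff_dir_sum U k (h : 'I_k -> M -> R^o) (Y : 'I_k -> M -> 'rV[R]_m) p u :
  open U -> U p -> (forall i, smooth_fun U (h i)) -> (forall i, smooth_field U (Y i)) ->
  sff_dir p u (fun x => \sum_i h i x *: Y i x) = \sum_i h i p *: sff_dir p u (Y i).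
Proof.
move=> oU Up sh sY.
have dY i := diff_along_push sF oU Up (sY i).
have dh i := smooth_dfunable (sh i) Up.
rewrite /sff_dir (nabla_sum cnM u oU Up); last by move=> i; exact: smooth_field_scale.
have E : push F (fun x => \sum_i h i x *: Y i x) = (fun x => \sum_i h i x *: push F (Y i) x).
  apply/funext => x; rewrite /push mulmx_suml.
  by apply: eq_bigr => i _; rewrite scalemxAl.
rewrite E (pullback_sum sF cnN); last by move=> i; exact: diff_along_scale.
rewrite mulmx_suml -sumrB; apply: eq_bigr => i _.
rewrite (pullback_scale sF cnN u (dh i) (dY i)) (nabla_scale cnM u oU Up (sh i) (sY i)).
rewrite mulmxDl -!scalemxAl scalerBr /push opprD addrACA subrr add0r.
by [].
Qed.

Lemma sff_dir_suml U k (a : 'I_k -> R) (v : 'I_k -> 'rV[R]_m) Y p :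
  open U -> U p -> smooth_field U Y ->
  sff_dir p (\sum_i a i *: v i) Y = \sum_i a i *: sff_dir p (v i) Y.
Proof.
move=> oU Up sY; have H := sff_dirP _ _ _ oU Up sY.
have H0 : sff_dir p 0 Y = 0.
  by apply: (addrI (sff_dir p 0 Y)); have := H 1 0 0; rewrite !scale1r !addr0 => <-.
elim: k a v => [|k IHk] a v; first by rewrite !big_ord0.
by rewrite !big_ord_recl H IHk.
Qed.

(** The frames differ by a matrix of functions [a]. Tensoriality takes [a] out of both slots, and
    its orthogonality at [p] contracts the double sum to the diagonal. *)
Lemma sff_trace_frame U U' k k' (E : 'I_k -> M -> 'rV[R]_m)
    (E' : 'I_k' -> M -> 'rV[R]_m) p :
  local_onframe gM (fun _ => 1%:M) U E -> local_onframe gM (fun _ => 1%:M) U' E' ->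
  U p -> U' p ->
  \sum_i sff_dir p (E i p) (E i) = \sum_i sff_dir p (E' i p) (E' i).
Proof.
move=> [oU sE fE] [oU' sE' fE'] Up U'p; pose A := U `&` U'.
have oA : open A by exact: openI.
have Ap : A p by [].
have {}sE i : smooth_field A (E i) by apply: smooth_field_sub (sE i) => q [].
have {}sE' i : smooth_field A (E' i) by apply: smooth_field_sub (sE' i) => q [].
pose a i j : M -> R^o := fun x => ip (gM x) (E' i x) (E j x).
have sa i j : smooth_fun A (a i j) by exact: smooth_ip.
have E'E i x : A x -> E' i x = \sum_j a i j x *: E j x.
  move=> [Ux _]; have [rE EA Eo] := fE _ Ux.
  exact: orthonormal_expand rE EA Eo (submx1 _).
(* Orthogonality of the columns of [a] is the orthonormality of [E] written in the basis [E']. *)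
have orth j l : \sum_i a i j p * a i l p = (j == l)%:R.
  have [rE EA Eo] := fE _ Up; have [rE' EA' Eo'] := fE' _ U'p.
  rewrite -Eo [in RHS](orthonormal_expand rE' EA' Eo' (submx1 (E j p))) ip_suml.
  apply: eq_bigr => i _.
  by rewrite ipZl /a (ipC (riem_metric_sym mgM p) (E j p)).
symmetry; under eq_bigr => i _.
  rewrite (sff_dir_near (E' i p) oA Ap (sE' i) _ (E'E i)); last first.
    by apply: smooth_field_sum => // j; exact: smooth_field_scale.
  rewrite (sff_dir_sum _ oA Ap (sa i) sE) (E'E i p Ap).
  under eq_bigr => l _ do rewrite (sff_dir_suml _ _ oA Ap (sE l)) scaler_sumr.
  over.
rewrite exchange_big /=; apply: eq_bigr => l _.
rewrite exchange_big /= (bigD1 l)//= [X in _ + X]big1 ?addr0.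
  under eq_bigr do rewrite scalerA.
  by rewrite -scaler_suml orth eqxx scale1r.
move=> j jl; under eq_bigr do rewrite scalerA.
by rewrite -scaler_suml orth eq_sym (negPf jl) scale0r.
Qed.

(** * Consequences of the isometry condition on the horizontal spaces *)

Section Riemannian.
Hypothesis rmF : riemannian_map gM gN F.

Lemma ker_perp_split p (u : 'rV[R]_m) : exists v w,
  [/\ v *m tangent_map F p = 0, (w <= ker_perp gM F p)%MS & u = v + w].
Proof.
have [v [w [vK wK ->]]] := sub_sum_split
  (orthcomp_full (riem_metric_pos mgM p) (ker_bundle F p) u).
by exists v, w; split=> //; exact/sub_kermxP.
Qed.

(** One argument may be arbitrary: its kernel component is killed on one side and orthogonal to [z]
    on the other. This matters for covariant derivatives of horizontal fields, which need not be
    horizontal. *)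
Lemma riemannian_ip p u z : (z <= ker_perp gM F p)%MS ->
  ip (gN (F p)) (u *m tangent_map F p) (z *m tangent_map F p) = ip (gM p) u z.
Proof.
move=> zK; have [v [w [vT wK ->]]] := ker_perp_split p u.
rewrite mulmxDl vT add0r rmF// ipDl (ipC (riem_metric_sym mgM p) v).
have /sub_orthcompP := zK; move=> /(_ v) ->; first by rewrite add0r.
exact/sub_kermxP.
Qed.

(** For horizontal [Y] and [Z] the functions g_N(F_*Y, F_*Z) and g_M(Y, Z) coincide near [p].
    Differentiate both by metric compatibility and use [riemannian_ip] to move the terms from [M] to
    [N]; the difference is the claimed skew-symmetry. *)
Lemma sff_skew U X Y Z p : open U -> U p ->
  smooth_field U X -> smooth_field U Y -> smooth_field U Z ->
  (forall x, U x -> (Y x <= ker_perp gM F x)%MS) ->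
  (forall x, U x -> (Z x <= ker_perp gM F x)%MS) ->
  ip (gN (F p)) (sff_dir p (X p) Y) (push F Z p) =
  - ip (gN (F p)) (sff_dir p (X p) Z) (push F Y p).
Proof.
move=> oU Up sX sY sZ YK ZK.
have dY := diff_along_push sF oU Up sY; have dZ := diff_along_push sF oU Up sZ.
have [_ EN] := pullback_metric (X p) dY dZ.
have [_ _ mc] := lcM; have EM := mc _ _ _ _ (X p) oU Up sY sZ.
have near_ip : \forall x \near p, ip (gN (F x)) (push F Y x) (push F Z x) = ip (gM x) (Y x) (Z x).
  by apply: (open_near oU Up) => x Ux; rewrite /push riemannian_ip//; exact: ZK.
have := etrans (esym EN) (etrans (dfun_near (X p) near_ip) EM).
rewrite /sff_dir !ipBl.
rewrite -[ip (gM p) (nablaM _ _ _) _]riemannian_ip; last exact: ZK.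
rewrite (ipC (riem_metric_sym mgM p) (Y p)).
rewrite -[ip (gM p) (nablaM _ _ _) (Y p)]riemannian_ip; last exact: YK.
rewrite (ipC (riem_metric_sym mgN _) (push F Y p)) -/(push F Y p) -/(push F Z p).
move: (ip _ (pb p (X p) (push F Y)) _) (ip _ (pb p (X p) (push F Z)) _)
  (ip _ (nablaM p (X p) Y *m _) _) (ip _ (nablaM p (X p) Z *m _) _) => a b c d E.
have -> : a = c + d - b by rewrite -E addrK.
by ring.
Qed.

(** Writing b(X, Y, Z) for the product of [sff_dir p (X p) Y] with [push F Z p]: b(X, X, Z) = - b(X,
    Z, X) = - b(Z, X, X), and b(Z, X, X) equals its own negative. *)
Lemma sff_orthogonal U X Z p : open U -> U p -> smooth_field U X -> smooth_field U Z ->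
  (forall x, U x -> (X x <= ker_perp gM F x)%MS) ->
  (forall x, U x -> (Z x <= ker_perp gM F x)%MS) ->
  ip (gN (F p)) (sff_dir p (X p) X) (push F Z p) = 0.
Proof.
move=> oU Up sX sZ XK ZK.
rewrite (sff_skew oU Up sX sX sZ XK ZK) (sff_sym oU Up sX sZ).
have := sff_skew oU Up sZ sX sX XK XK; move: (ip _ _ _) => t /eqP.
by rewrite -addr_eq0 -mulr2n mulrn_eq0 /= => /eqP ->; rewrite oppr0.
Qed.

(** [sff_orthogonal] tests against smooth horizontal fields, so a range vector at [p] is first
    expanded in the images of the frame [E]. *)
Lemma sff_range_perp U X k (E : 'I_k -> M -> 'rV[R]_m) p :
  local_onframe gM (ker_perp gM F) U E -> U p ->
  smooth_field U X -> (forall x, U x -> (X x <= ker_perp gM F x)%MS) ->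
  (sff_dir p (X p) X <= range_perp gN F p)%MS.
Proof.
move=> [oU sE fE] Up sX XK; apply/sub_orthcompP => v.
rewrite genmxE => /submxP[u ->].
have [w [z [wT zK ->]]] := ker_perp_split p u.
have [rE EK Eo] := fE _ Up.
rewrite mulmxDl wT add0r (orthonormal_expand rE EK Eo zK) mulmx_suml ip_sumr.
rewrite big1// => i _; rewrite -scalemxAl ipZr.
have EK' x : U x -> (E i x <= ker_perp gM F x)%MS by move=> /fE[_ + _]; apply.
have S := sff_orthogonal oU Up sX (sE i) XK EK'.
by apply: etrans (congr1 (fun t => _ * t) S) _; rewrite mulr0.
Qed.

End Riemannian.

End SecondFundamentalForm.

(** * Semi-invariant maps *)

Section DifferentiableInverse.
Context {R : realType} {m : nat} {M : manifold R m}.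
Implicit Types (p x : M).

Lemma dfunable_cst p (a : R) : dfunable (fun _ : M => a : R^o) p.
Proof. exact: differentiable_cst. Qed.

Lemma dfunable_sum p (I : Type) (s : seq I) (h : I -> M -> R^o) :
  (forall i, dfunable (h i) p) -> dfunable (fun x => \sum_(i <- s) h i x : R^o) p.
Proof.
move=> dh; elim: s => [|i s IHs].
  have -> : (fun x => \sum_(i <- [::]) h i x : R^o) = (fun _ => 0).
    by apply/funext => x; rewrite big_nil.
  exact: dfunable_cst.
have -> : (fun x => \sum_(j <- i :: s) h j x : R^o) =
    (fun x => h i x + \sum_(j <- s) h j x).
  by apply/funext => x; rewrite big_cons.
exact: dfunableD.
Qed.

Lemma dfunable_prod p (I : Type) (s : seq I) (h : I -> M -> R^o) :
  (forall i, dfunable (h i) p) -> dfunable (fun x => \prod_(i <- s) (h i x : R) : R^o) p.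
Proof.
move=> dh; elim: s => [|i s IHs].
  have -> : (fun x => \prod_(i <- [::]) (h i x : R) : R^o) = (fun _ => 1).
    by apply/funext => x; rewrite big_nil.
  exact: dfunable_cst.
have -> : (fun x => \prod_(j <- i :: s) (h j x : R) : R^o) =
    (fun x => (h i x : R) * \prod_(j <- s) (h j x : R)).
  by apply/funext => x; rewrite big_cons.
exact: dfunableM.
Qed.

Lemma dfunable_det p k (A : M -> 'M[R]_k) :
  (forall i j, dfunable (fun x => A x i j : R^o) p) ->
  dfunable (fun x => \det (A x) : R^o) p.
Proof.
move=> dA; rewrite /determinant; apply: dfunable_sum => s.
apply: dfunableM; first exact: dfunable_cst.
by apply: dfunable_prod => i; exact: dA.
Qed.

Lemma dfunable_inv p (h : M -> R^o) : dfunable h p -> (h p : R) != 0 ->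
  dfunable (fun x => (h x : R)^-1 : R^o) p.
Proof.
move=> dh h0; apply: (@differentiableV _ _ (h \o cinv p)) => //.
by rewrite /= cmapK//; exact: mem_cdom.
Qed.

(** The inverse is written by Cramer's rule, so that its entries are visibly signed minors divided
    by the determinant. *)
Lemma dfunable_inv_adj p k (A : M -> 'M[R]_k) i j :
  (forall i j, dfunable (fun x => A x i j : R^o) p) -> \det (A p) != 0 ->
  dfunable (fun x => ((\det (A x))^-1 *: \adj (A x)) i j : R^o) p.
Proof.
move=> dA A0.
have -> : (fun x => ((\det (A x))^-1 *: \adj (A x)) i j : R^o) =
    (fun x => (\det (A x))^-1 * ((-1) ^+ (j + i) * \det (row' j (col' i (A x))))).
  by apply/funext => x; rewrite !mxE.
apply: dfunableM; first by apply: dfunable_inv => //; exact: dfunable_det.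
apply: dfunableM; first exact: dfunable_cst.
apply: dfunable_det => a b.
have -> : (fun x => row' j (col' i (A x)) a b : R^o) =
    (fun x => A x (lift j a) (lift i b)).
  by apply/funext => x; rewrite !mxE.
exact: dA.
Qed.

End DifferentiableInverse.

(** * Gram matrices and orthogonal projection *)

Section GramMatrix.
Context {R : realType} {n : nat} (G : 'M[R]_n).
Hypothesis Gpos : forall v, v != 0 -> 0 < ip G v v.

Definition gram k (E : 'I_k -> 'rV[R]_n) : 'M[R]_k := \matrix_(i, j) ip G (E i) (E j).

Lemma gram_coeff k (E : 'I_k -> 'rV[R]_n) (c : 'rV[R]_k) j :
  ip G (\sum_i c 0 i *: E i) (E j) = (c *m gram E) 0 j.
Proof.
by rewrite ip_suml mxE; apply: eq_bigr => i _; rewrite ipZl !mxE.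
Qed.

(** A row vector killed by the Gram matrix gives a combination of the [E i] orthogonal to itself,
    hence zero, and freeness makes its coefficients vanish. *)
Lemma det_gram k (E : 'I_k -> 'rV[R]_n) :
  row_free (\matrix_i E i) -> \det (gram E) != 0.
Proof.
move=> Ef; rewrite -unitfE -[_ \in _]/(gram E \in unitmx) -row_free_unit -kermx_eq0.
apply/eqP/row_matrixP => l; set c := row l _.
have cG : c *m gram E = 0 by apply/sub_kermxP; exact: row_sub.
have cE : c *m (\matrix_i E i) = \sum_i c 0 i *: E i.
  by rewrite mulmx_sum_row; apply: eq_bigr => i _; rewrite rowK.
rewrite row0; apply: (row_free_inj Ef); rewrite mul0mx cE; apply: (ip_eq0 Gpos).
rewrite [X in ip G _ X](eq_bigr (fun i => c 0 i *: E i))// ip_sumr big1// => j _.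
by rewrite ipZr gram_coeff cG [X in _ * X]mxE mulr0.
Qed.

(** These are the normal equations: the coefficients of [d], multiplied by the Gram matrix, give the
    products of [u] with the [E j], since [w] contributes nothing. The frame is only independent, so
    the inverse Gram matrix appears. *)
Lemma orth_proj_coeff k (E : 'I_k -> 'rV[R]_n) (A : 'M[R]_n) d w u :
  row_free (\matrix_i E i) -> (\matrix_i E i == A)%MS -> (d <= A)%MS ->
  (forall v, (v <= A)%MS -> ip G w v = 0) -> u = d + w ->
  d = \sum_i (\sum_j ip G u (E j) * ((\det (gram E))^-1 *: \adj (gram E)) j i) *: E i.
Proof.
move=> Ef /andP[EA AE] dA wA ->.
have G0 := det_gram Ef.
have /submxP[c dc] := submx_trans dA AE.
have dE : d = \sum_i c 0 i *: E i.
  by rewrite dc mulmx_sum_row; apply: eq_bigr => i _; rewrite rowK.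
rewrite {1}dE; apply: eq_bigr => i _; congr (_ *: _).
have wE j : ip G w (E j) = 0.
  apply: wA; apply: submx_trans EA.
  by rewrite -[X in (X <= _)%MS](rowK E j); exact: row_sub.
transitivity ((c *m gram E *m ((\det (gram E))^-1 *: \adj (gram E))) 0 i).
  by rewrite -mulmxA -scalemxAr mul_mx_adj scale_scalar_mx mulVf// mulmx1.
rewrite mxE; apply: eq_bigr => j _; congr (_ * _).
by rewrite ipDl wE addr0 [in RHS]dE gram_coeff.
Qed.

End GramMatrix.

(** * Pointwise algebra of the semi-invariant splitting *)

Section SemiInvariantPointwise.
Context {R : realType} {m n : nat} {M : manifold R m} {N : manifold R n}.
Variables (gN : N -> 'M[R]_n) (P : N -> 'M[R]_n) (F : M -> N) (D1 D2 : M -> 'M[R]_n).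
Hypothesis mgN : is_metric gN.
Hypothesis Pip : forall q u v, ip (gN q) (u *m P q) (v *m P q) = ip (gN q) u v.
Hypothesis si : semi_invariant gN F P D1 D2.
Implicit Types (p x : M) (u v w : 'rV[R]_n).

Let gsym p := riem_metric_sym mgN (F p).
Let gpos p := riem_metric_pos mgN (F p).

Lemma si_D1_range p : (D1 p <= range_bundle F p)%MS.
Proof.
by case: si => _ _ /(_ p)[/andP[+ _] _ _ _]; apply: submx_trans; exact: addsmxSl.
Qed.

Lemma si_D2_range p : (D2 p <= range_bundle F p)%MS.
Proof.
by case: si => _ _ /(_ p)[/andP[+ _] _ _ _]; apply: submx_trans; exact: addsmxSr.
Qed.

Lemma si_PD2_perp p : (PD2 F P D2 p <= range_perp gN F p)%MS.
Proof. by case: si => _ _ /(_ p)[_ _ _]. Qed.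

Lemma range_perp_ip p u v : (u <= range_perp gN F p)%MS -> (v <= range_bundle F p)%MS ->
  ip (gN (F p)) u v = 0.
Proof. by move=> /sub_orthcompP; apply. Qed.

Lemma range_cap p : (range_bundle F p :&: range_perp gN F p)%MS = 0.
Proof. exact: (orthcomp_cap (gpos p) (range_bundle F p)). Qed.

Lemma perp_cap p : (range_perp gN F p :&: range_bundle F p)%MS = 0.
Proof. by rewrite capmxC range_cap. Qed.

Lemma range_perp_split p v : v = range_part gN F p v + perp_part gN F p v.
Proof.
rewrite /range_part /perp_part add_proj_mx ?range_cap//.
exact: (orthcomp_full (gpos p) (range_bundle F p) v).
Qed.

Lemma range_part_sub p v : (range_part gN F p v <= range_bundle F p)%MS.
Proof. exact: proj_mx_sub. Qed.

Lemma perp_part_sub p v : (perp_part gN F p v <= range_perp gN F p)%MS.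
Proof. exact: proj_mx_sub. Qed.

Lemma perp_part_eq p u v : (u <= range_bundle F p)%MS -> (v <= range_perp gN F p)%MS ->
  perp_part gN F p (u + v) = v.
Proof. by move=> uA vB; rewrite addrC /perp_part proj_mx_add// perp_cap. Qed.

Lemma D1_PD2_cap p : (D1 p :&: PD2 F P D2 p)%MS = 0.
Proof.
apply/eqP; rewrite -submx0 -(range_cap p); apply: capmxS.
  exact: si_D1_range.
exact: si_PD2_perp.
Qed.

Lemma range_P_sub p u : (u <= range_bundle F p)%MS -> (u *m P (F p) <= D1 p + PD2 F P D2 p)%MS.
Proof.
case: si => _ _ /(_ p)[/andP[_ rD] _ /andP[DP _] _] ur.
have [v [w [vD wD ->]]] := sub_sum_split (submx_trans ur rD).
rewrite mulmxDl; apply: addmx_sub_adds; last exact: submxMr.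
exact: submx_trans (submxMr _ vD) DP.
Qed.

Lemma phi_omega p u : (u <= range_bundle F p)%MS ->
  u *m P (F p) = phi F P D1 D2 p u + omega F P D1 D2 p u.
Proof.
by move=> ur; rewrite /phi /omega add_proj_mx ?D1_PD2_cap//; exact: range_P_sub.
Qed.

Lemma phi_sub p u : (phi F P D1 D2 p u <= D1 p)%MS.
Proof. exact: proj_mx_sub. Qed.

Lemma omega_sub p u : (omega F P D1 D2 p u <= PD2 F P D2 p)%MS.
Proof. exact: proj_mx_sub. Qed.

(** [D1] lies in the range and [PD2] in its complement, so splitting along them refines the
    splitting of the tangent space of [N]; projecting onto [PD2] becomes taking the normal part. *)
Lemma omegaE p u : (u <= range_bundle F p)%MS ->
  omega F P D1 D2 p u = perp_part gN F p (u *m P (F p)).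
Proof.
move=> ur; rewrite phi_omega// perp_part_eq//.
  exact: submx_trans (phi_sub _ _) (si_D1_range _).
exact: submx_trans (omega_sub _ _) (si_PD2_perp _).
Qed.

(** The point is that the normal part of P v already lies in [eta]: for d in [D2], g(P v, P d) =
    g(v, d) = 0, and the range part of P v is orthogonal to P d as well. *)
Lemma CpartE p v : (v <= range_perp gN F p)%MS ->
  Cpart gN F P D2 p v = perp_part gN F p (v *m P (F p)).
Proof.
move=> vp; set b := perp_part _ _ _ _.
have beta : (b <= eta gN F P D2 p)%MS.
  rewrite sub_capmx perp_part_sub /=; apply/sub_orthcompP => _ /submxP[c ->].
  rewrite /PD2 mulmxA; set d := c *m D2 p.
  have dr : (d <= range_bundle F p)%MS by apply: submx_trans (submxMl _ _) (si_D2_range p).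
  have dp : (d *m P (F p) <= range_perp gN F p)%MS.
    by apply: submx_trans (si_PD2_perp p); apply: submxMr; exact: submxMl.
  have := Pip (F p) v d; rewrite (range_perp_ip vp dr).
  rewrite (range_perp_split p (v *m P (F p))) ipDl.
  rewrite (ipC (gsym p) (range_part _ _ _ _)) (range_perp_ip dp (range_part_sub _ _)).
  by rewrite add0r.
rewrite /Cpart {1}(range_perp_split p (v *m P (F p))) addrC proj_mx_add//.
  apply/eqP; rewrite -submx0 -(perp_cap p); apply: capmxS => //; exact: capmxSl.
exact: range_part_sub.
Qed.

Lemma perp_partD p u v :
  perp_part gN F p (u + v) = perp_part gN F p u + perp_part gN F p v.
Proof. by rewrite /perp_part mulmxDl. Qed.

Lemma perp_partN p u : perp_part gN F p (- u) = - perp_part gN F p u.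
Proof. by rewrite /perp_part mulNmx. Qed.

End SemiInvariantPointwise.

(** * The Kähler identity along the map *)

Section SemiInvariant.
Context {R : realType} {m n : nat} {M : manifold R m} {N : manifold R n}.
Variables (gN : N -> 'M[R]_n) (nablaN : connection_op N) (P : N -> 'M[R]_n).
Variables (F : M -> N) (D1 D2 : M -> 'M[R]_n).
Hypothesis mgN : is_metric gN.
Hypothesis lcN : is_levi_civita gN nablaN.
Hypothesis kP : is_kahler gN nablaN P.
Hypothesis sF : smooth_map F.
Hypothesis si : semi_invariant gN F P D1 D2.
Implicit Types (U : set M) (p q x : M) (V W : M -> 'rV[R]_n) (h : M -> R^o).
Implicit Types (X Y Z : M -> 'rV[R]_m).

Let cnN : is_connection nablaN. Proof. by case: lcN. Qed.
Let PP (q : N) : P q *m P q = - 1%:M. Proof. by case: kP. Qed.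
Let Pip (q : N) u v : ip (gN q) (u *m P q) (v *m P q) = ip (gN q) u v.
Proof. by case: kP. Qed.

Local Notation pb := (pullback_connection nablaN F).

(** On a coordinate field of [N], applying [P] gives a smooth field on [N], so [pullback_comp]
    reduces the claim to parallelism of [P] for [nablaN]; Leibniz rules extend it to fields along
    [F]. *)
Lemma pullback_parallel p v V : diff_along F p V ->
  diff_along F p (fun x => V x *m P (F x)) /\
  pb p v (fun x => V x *m P (F x)) = pb p v V *m P (F p).
Proof.
move: V; apply: (diff_along_ind sF).
- move=> V W VW dV [dVP E].
  have VWP : \forall x \near p, V x *m P (F x) = W x *m P (F x).
    by apply: filterS VW => x ->.
  split; first exact: diff_along_near VWP dVP.
  by rewrite -(pullback_near sF nablaN v VWP) -(pullback_near sF nablaN v VW).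
- have -> : (fun x : M => (0 : 'rV[R]_n) *m P (F x)) = (fun _ => 0).
    by apply/funext => x; rewrite mul0mx.
  rewrite (pullback0 sF cnN) mul0mx; split=> //.
  have -> : (fun _ : M => 0) = const_field (F p) 0 \o F :> (M -> 'rV[R]_n).
    by apply/funext => x; rewrite /= /const_field mul0mx.
  exact: diff_along_const.
- move=> V W dV dW [dVP EV] [dWP EW].
  have -> : (fun x => (V x + W x) *m P (F x)) = (fun x => V x *m P (F x) + W x *m P (F x)).
    by apply/funext => x; rewrite mulmxDl.
  split; first exact: diff_alongD.
  by rewrite (pullbackD sF cnN v dVP dWP) (pullbackD sF cnN v dV dW) EV EW -mulmxDl.
- move=> h V dh dV [dVP E].
  have -> : (fun x => (h x *: V x) *m P (F x)) = (fun x => h x *: (V x *m P (F x))).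
    by apply/funext => x; rewrite scalemxAl.
  split; first exact: diff_along_scale.
  rewrite (pullback_scale sF cnN v dh dVP) (pullback_scale sF cnN v dh dV) E.
  by move: (pb p v V) => B; rewrite mulmxDl -!scalemxAl.
- move=> u; have oc := open_cdom (F p); have Fc := mem_cdom (F p).
  have su := smooth_const_field (F p) u.
  have [sP _ _ nP] := kP.
  have [E d] := pullback_comp sF cnN v oc Fc (sP _ _ oc su).
  split; first exact: d.
  rewrite (pullback_const sF nablaN p v u); apply: etrans E _.
  exact: nP oc Fc su.
Qed.

(** An orthogonal component inherits differentiability from the whole: in a smooth local frame of
    [A] its coefficients are inner products with the frame times entries of the inverse Gram
    matrix. *)
Lemma diff_along_subbundle_part A p V W : is_subbundle_along F A ->
  (forall x, (V x <= A x)%MS) ->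
  (forall x v, (v <= A x)%MS -> ip (gN (F x)) (W x) v = 0) ->
  diff_along F p (fun x => V x + W x) -> diff_along F p V.
Proof.
move=> sA VA WA dVW; have [U [oU Up [k [E [sE fE]]]]] := sA p.
have dE i : diff_along F p (E i).
  apply: smooth_on_diff (sE i p (F p)) _.
  by exists p => //; split; [split|] => //; exact: mem_cdom.
pose Gr x := gram (gN (F x)) (fun i => E i x).
have [Efp _] := fE _ Up.
have G0 : \det (Gr p) != 0 := det_gram (riem_metric_pos mgN (F p)) Efp.
have dG i j : dfunable (fun x => Gr x i j : R^o) p.
  have -> : (fun x => Gr x i j : R^o) = (fun x => ip (gN (F x)) (E i x) (E j x)).
    by apply/funext => x; rewrite mxE.
  (* The direction 0 is arbitrary: only the differentiability half of [metric_leibniz] is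
     extracted. *)
  by have [] := pullback_metric mgN lcN sF 0 (dE i) (dE j).
pose c i x : R^o := \sum_j ip (gN (F x)) (V x + W x) (E j x) *
  ((\det (Gr x))^-1 *: \adj (Gr x)) j i.
have dc i : dfunable (c i) p.
  apply: dfunable_sum => j; apply: dfunableM.
    by have [] := pullback_metric mgN lcN sF 0 dVW (dE j).
  exact: dfunable_inv_adj.
have near_V : \forall x \near p, \sum_i c i x *: E i x = V x.
  apply: (open_near oU Up) => x Ux; have [Ef EA] := fE _ Ux; symmetry.
  exact: (orth_proj_coeff (riem_metric_pos mgN (F x)) Ef EA (VA x) (WA x)).
apply: (diff_along_near near_V); apply: (diff_along_sum sF) => i.
exact: diff_along_scale.
Qed.

(** Let a and w be the derivatives of the [phi] and [omega] parts of P F_*X. Since P^2 = -1, the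
    derivative of F_*X is - (a + w) P, acting on row vectors. In its normal part, a P is the
    derivative of P phi F_*X, while the range and normal components of w give the [omega] and
    [Cpart] terms; the sign in [shape_op] accounts for the plus sign of the former. *)
Lemma clairaut_trace_termE U X p : open U -> U p -> smooth_field U X ->
  clairaut_trace_term gN nablaN F P D1 D2 X p =
  perp_part gN F p (pb p (X p) (push F X)).
Proof.
move=> oU Up sX; set Y := push F X; set v := X p.
pose A x := phi F P D1 D2 x (Y x); pose W x := omega F P D1 D2 x (Y x).
have Yr x : (Y x <= range_bundle F x)%MS by rewrite genmxE; exact: submxMl.
have YAW x : Y x *m P (F x) = A x + W x by exact: phi_omega mgN si _ _ (Yr x).
have dY : diff_along F p Y := diff_along_push sF oU Up sX.
have [dYP EYP] := pullback_parallel v dY.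
have YPE : (fun x => Y x *m P (F x)) = (fun x => A x + W x) by exact/funext.
have dA : diff_along F p A.
  have [sD1 _ _] := si.
  apply: (@diff_along_subbundle_part D1 p A W sD1) => //.
  - by move=> x; exact: phi_sub.
  - move=> x w wD; apply: (@range_perp_ip _ _ _ _ _ gN F x).
      exact: submx_trans (omega_sub _ _ _ _ _ _) (si_PD2_perp si x).
    exact: submx_trans wD (si_D1_range si x).
  - by rewrite -YPE.
(* With [A] known to be differentiable, [W] is obtained by subtraction from the field P F_*X. *)
have dW : diff_along F p W.
  have -> : W = (fun x => Y x *m P (F x) + (-1 : R) *: A x).
    by apply/funext => x; rewrite YAW scaleN1r addrC addKr.
  exact: diff_alongD dYP (diff_along_scale (dfunable_cst p (-1)) dA).
have [dAP EAP] := pullback_parallel v dA.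
have E : pb p v Y *m P (F p) = pb p v A + pb p v W.
  by rewrite -EYP YPE (pullbackD sF cnN v dA dW).
have EY : pb p v Y = - ((pb p v A + pb p v W) *m P (F p)).
  by rewrite -E -mulmxA PP mulmxN mulmx1 opprK.
rewrite /clairaut_trace_term -/Y /shape_op /normal_conn.
rewrite -[pullback_connection _ _ _ _ (fun q => phi _ _ _ _ _ _ *m _)]
  /(pb p v (fun x => A x *m P (F x))).
rewrite EAP EY.
rewrite -[pullback_connection nablaN F p (X p) (fun q => omega _ _ _ _ _ _)]/(pb p v W).
move: (pb p v A) (pb p v W) => a w.
rewrite (omegaE mgN si); last by rewrite -scaleN1r; apply: scalemx_sub; exact: range_part_sub.
rewrite (CpartE mgN Pip si); last exact: perp_part_sub.
rewrite mulNmx !perp_partN mulmxDl perp_partD.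
(* The third occurrence of [w] is the one on the right-hand side, the only one still to be split. *)
rewrite {3}(range_perp_split F mgN p w) mulmxDl perp_partD.
by rewrite !opprD addrC.
Qed.

End SemiInvariant.

(** * Traces *)

Lemma local_onframe_sub (R : realType) m (M : manifold R m) (g K : M -> 'M[R]_m)
    (U V : set M) k (E : 'I_k -> M -> 'rV[R]_m) :
  open V -> V `<=` U -> local_onframe g K U E -> local_onframe g K V E.
Proof.
move=> oV VU [_ sE fE]; split=> // [i|p /VU/fE//].
exact: smooth_field_sub (sE i).
Qed.

Definition join_fields {T W : Type} k l (X : 'I_k -> T -> W) (K : 'I_l -> T -> W)
    (i : 'I_(k + l)) : T -> W :=
  match fintype.split i with inl j => X j | inr j => K j end.

Lemma big_join_fields {T W : Type} (V : nmodType) k l (X : 'I_k -> T -> W)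
    (K : 'I_l -> T -> W) (f : (T -> W) -> V) :
  \sum_i f (join_fields X K i) = \sum_i f (X i) + \sum_i f (K i).
Proof.
rewrite big_split_ord; congr (_ + _); apply: eq_bigr => i _.
  by rewrite /join_fields (unsplitK (inl i)).
by rewrite /join_fields (unsplitK (inr i)).
Qed.

Section Trace.
Context {R : realType} {m n : nat} {M : manifold R m} {N : manifold R n}.
Variables (gM : M -> 'M[R]_m) (gN : N -> 'M[R]_n).
Variables (nablaM : connection_op M) (nablaN : connection_op N).
Variables (F : M -> N) (r : nat).
Hypothesis mgM : is_metric gM.
Hypothesis mgN : is_metric gN.
Hypothesis lcM : is_levi_civita gM nablaM.
Hypothesis lcN : is_levi_civita gN nablaN.
Hypothesis sF : smooth_map F.
Implicit Types (U : set M) (p q x : M) (X Y Z : M -> 'rV[R]_m).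

Lemma join_onframe U k l (X : 'I_k -> M -> 'rV[R]_m) (K : 'I_l -> M -> 'rV[R]_m) :
  local_onframe gM (ker_perp gM F) U X -> local_onframe gM (ker_bundle F) U K ->
  local_onframe gM (fun _ => 1%:M) U (join_fields X K).
Proof.
move=> [oU sX fX] [_ sK fK]; split=> // [i|p Up].
  by rewrite /join_fields; case: (fintype.split i).
have [rX XA Xo] := fX _ Up; have [rK KA Ko] := fK _ Up.
have XK i j : ip (gM p) (X i p) (K j p) = 0.
  by have /sub_orthcompP := XA i; apply.
split=> [|i|i j]; last 2 first.
- exact: submx1.
- rewrite /join_fields -{2}(splitK i) -{2}(splitK j).
  case: (fintype.split i) (fintype.split j) => [i'|i'] [j'|j'].
  + by rewrite Xo (inj_eq (@lshift_inj _ _)).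
  + by rewrite XK eq_lrshift.
  + by rewrite (ipC (riem_metric_sym mgM p)) XK eq_rlshift.
  + by rewrite Ko (inj_eq (@rshift_inj _ _)).
(* The count of fields is right because a subspace and its orthogonal complement have complementary
   ranks. *)
rewrite mxrank1 -rX -rK rank_orthcomp; last exact: riem_metric_pos mgM p.
by rewrite addnC subnKC// rank_leq_col.
Qed.

Lemma sff_trace_ker U l (K : 'I_l -> M -> 'rV[R]_m) p :
  minimal_fibres gM nablaM F -> local_onframe gM (ker_bundle F) U K -> U p ->
  \sum_i sff_dir nablaM nablaN F p (K i p) (K i) = 0.
Proof.
move=> minF oK Up; have [oU sK fK] := oK; have cnN : is_connection nablaN by case: lcN.
(* Minimality constrains the sum only, so it is the whole of [w], and not each summand, that lies in
   the kernel. *)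
pose w := \sum_i nablaM p (K i p) (K i).
have wp : w *m proj_mx (ker_perp gM F p) (ker_bundle F p) = 0.
  by rewrite mulmx_suml; exact: minF oK _ Up.
have gpos := riem_metric_pos mgM p.
have capK : (ker_perp gM F p :&: ker_bundle F p)%MS = 0.
  by rewrite capmxC; exact: (orthcomp_cap gpos (ker_bundle F p)).
have wK : (w <= ker_bundle F p)%MS.
  have full : (w <= ker_perp gM F p + ker_bundle F p)%MS.
    by rewrite addsmxC; exact: (orthcomp_full gpos (ker_bundle F p) w).
  by have := add_proj_mx capK full; rewrite wp add0r => <-; exact: proj_mx_sub.
transitivity (- (w *m tangent_map F p)); last by move/sub_kermxP: wK => ->; rewrite oppr0.
rewrite /w mulmx_suml -sumrN; apply: eq_bigr => i _.
have K0 : \forall x \near p, push F (K i) x = 0.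
  apply: (open_near oU Up) => x /fK[_ KA _].
  by have /sub_kermxP := KA i.
have pK := @pullback_near _ _ _ _ _ F sF nablaN p (K i p) (push F (K i)) (fun _ => 0) K0.
by rewrite /sff_dir pK (pullback0 sF cnN) sub0r.
Qed.

Hypothesis rmF : riemannian_map gM gN F.
Hypothesis minF : minimal_fibres gM nablaM F.
Hypothesis rF : forall p, \rank (tangent_map F p) = r.

(** Images under F_* have no normal part, so [sff_dir] and the derivative of F_*X share theirs.
    Vanishing of the full trace gives vanishing of its normal part; the converse uses that the
    horizontal summands are already normal. *)
Lemma harmonicE : harmonic_map gM nablaM nablaN F <->
  trace_vanishes gM (ker_perp gM F)
    (fun X p => perp_part gN F p (pullback_connection nablaN F p (X p) (push F X))).
Proof.
have perp_sff p u (Y : M -> 'rV[R]_m) :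
    perp_part gN F p (sff_dir nablaM nablaN F p u Y) =
    perp_part gN F p (pullback_connection nablaN F p u (push F Y)).
  rewrite /sff_dir; move: (pullback_connection _ _ _ _ _) => w.
  rewrite perp_partD -[RHS]addr0; congr (_ + _); rewrite -[- _]addr0.
  by rewrite (perp_part_eq mgN) ?sub0mx// -mulNmx genmxE submxMl.
split=> [harmF U k X oX p Up|perpF U k E oE p Up].
  (* Only the kernel half of the adapted pair is kept; it completes the given frame [X] on the
     intersection of the two domains. *)
  have [U' [_ [K [U'p _ oK]]]] := adapted_frame_exists mgM sF rF p.
  have [oU sX fX] := oX; have [oU' _ _] := oK.
  have oA : open (U `&` U') by exact: openI.
  have oX' := local_onframe_sub oA (@subIsetl _ _ _) oX.
  have oK' := local_onframe_sub oA (@subIsetr _ _ _) oK.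
  have Ap : (U `&` U') p by [].
  have := harmF _ _ _ (join_onframe oX' oK') p Ap.
  rewrite (big_join_fields X K (fun Z => sff_dir nablaM nablaN F p (Z p) Z)).
  rewrite (sff_trace_ker minF oK U'p) addr0 => XT.
  under eq_bigr do rewrite -perp_sff.
  by rewrite /perp_part -mulmx_suml XT mul0mx.
have [U' [X [K [U'p oX oK]]]] := adapted_frame_exists mgM sF rF p.
have [oU' sX fX] := oX.
have XK i x : U' x -> (X i x <= ker_perp gM F x)%MS by move=> /fX[].
rewrite -[LHS]/(\sum_i sff_dir nablaM nablaN F p (E i p) (E i)).
(* The given frame [E] is unrelated to the splitting, so it is first exchanged for the adapted
   one. *)
rewrite (sff_trace_frame mgM lcM lcN sF oE (join_onframe oX oK) Up U'p).
rewrite (big_join_fields X K (fun Z => sff_dir nablaM nablaN F p (Z p) Z)).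
rewrite (sff_trace_ker minF oK U'p) addr0 -[RHS](perpF _ _ _ oX p U'p).
apply: eq_bigr => i _; rewrite -perp_sff -[X in perp_part _ _ _ X]add0r.
rewrite (perp_part_eq mgN) ?sub0mx//.
exact: (sff_range_perp mgM mgN lcM lcN sF rmF oX U'p (sX i) (XK i)).
Qed.

End Trace.

Theorem theorem8 (R : realType) (m n r : nat)
  (M : manifold R m) (N : manifold R n)
  (gM : M -> 'M[R]_m) (gN : N -> 'M[R]_n)
  (nablaM : connection_op M) (nablaN : connection_op N)
  (P : N -> 'M[R]_n) (F : M -> N)
  (rangeN : N -> 'M[R]_n) (D1 D2 : M -> 'M[R]_n) (f : N -> R)
  (metricM : is_metric gM) (metricN : is_metric gN)
  (levi_civitaM : is_levi_civita gM nablaM)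
  (levi_civitaN : is_levi_civita gN nablaN)
  (kahlerN : is_kahler gN nablaN P)
  (smoothF : smooth_map F)
  (rankF : forall p, \rank (tangent_map F p) = r)
  (rank_bounds : (0 < r < minn m n)%N)
  (riemannianF : riemannian_map gM gN F)
  (semi_invariantF : semi_invariant gN F P D1 D2)
  (distribution_rangeN : is_distribution rangeN)
  (rangeN_F : forall p, (rangeN (F p) == tangent_map F p)%MS)
  (smoothf : smooth_fun setT f)
  (clairautF : clairaut gN nablaN rangeN (fun q => expR (f q)))
  (geodesic_perp :
     totally_geodesic nablaN (fun q => orthcomp (gN q) (rangeN q)))
  (minimal_ker : minimal_fibres gM nablaM F) :
  harmonic_map gM nablaM nablaN F <->
  trace_vanishes gM (ker_perp gM F) (clairaut_trace_term gN nablaN F P D1 D2).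
Proof.
rewrite (harmonicE metricM metricN levi_civitaM levi_civitaN smoothF riemannianF
  minimal_ker rankF).
have termE U k (X : 'I_k -> M -> 'rV[R]_m) p :
    local_onframe gM (ker_perp gM F) U X -> U p ->
    \sum_i clairaut_trace_term gN nablaN F P D1 D2 (X i) p =
    \sum_i perp_part gN F p (pullback_connection nablaN F p (X i p) (push F (X i))).
  move=> [oU sX _] Up; apply: eq_bigr => i _.
  exact: (clairaut_trace_termE metricN levi_civitaN kahlerN smoothF semi_invariantF
    oU Up (sX i)).
split=> H U k X oX p Up.
  by rewrite (termE _ _ _ _ oX Up); exact: H oX p Up.
by rewrite -(termE _ _ _ _ oX Up); exact: H oX p Up.
Qed.
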